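(* Let $\eta=(\eta(t))_{t\in\mathbb{Z}}$ be a stationary simple max-stable process satisfying the Markov property. Then there exists $a\in[0,1]$ such that $\eta$ is equal in distribution either to the max-AR(1) process $X_a$ or to the time-reversed max-AR(1) process $\check X_a$.
   Context: A random process $\eta=(\eta(t))_{t\in T}$ is simple max-stable if $\mathbb{P}[\eta(t)\le y]=\exp(-1/y)$ for all $t\in T$, $y>0$ (standard $1$-Fréchet marginals), and $n^{-1}\bigvee_{i=1}^n\eta_i\stackrel{d}{=}\eta$ for all $n\ge1$, where $(\eta_i)_{i\ge1}$ are independent copies of $\eta$ and $\bigvee$ denotes the pointwise maximum. Let $(F_n)_{n\in\mathbb{Z}}$ be i.i.d. standard $1$-Fréchet random variables. For $a\in[0,1)$ the max-AR(1) process is $X_a(t)=\bigvee_{n\le t}(1-a)a^{t-n}F_n$, $t\in\mathbb{Z}$ (with $0^0=1$), and $X_1(t)\equiv F_0$. The time-reversed max-AR(1) process is $\check X_a(t)=\bigvee_{n\ge t}(1-a)a^{n-t}F_n$ for $a\in[0,1)$, and $\check X_1(t)\equiv F_0$. *)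

(* Defs.v *)
From HB Require Import structures.
From mathcomp Require Import all_boot all_order all_algebra.
From mathcomp Require Import all_classical all_reals all_analysis.
Set Implicit Arguments. Unset Strict Implicit. Unset Printing Implicit Defensive.
Import Order.TTheory GRing.Theory Num.Theory.
Local Open Scope classical_set_scope.
Local Open Scope ring_scope.

Section Defs.
Context {R : realType}.

Definition cyl {T : Type} (xi : int -> T -> R) (ts : seq int) (Bs : nat -> set R)
  : set T :=
  \bigcap_(i in `I_(size ts)) (xi (nth 0 ts i) @^-1` Bs i).

(* Equality in distribution of two real processes indexed by Z (possibly on
   different probability spaces): equality of all finite-dimensional
   distributions (checked on measurable rectangles, a generating pi-system). *)
Definition eqd {d1 d2} {T1 : measurableType d1} {T2 : measurableType d2}
  (P1 : probability T1 R) (xi1 : int -> T1 -> R)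
  (P2 : probability T2 R) (xi2 : int -> T2 -> R) : Prop :=
  forall (ts : seq int) (Bs : nat -> set R),
    (forall i, measurable (Bs i)) -> P1 (cyl xi1 ts Bs) = P2 (cyl xi2 ts Bs).

Definition is_process {d} {T : measurableType d} (xi : int -> T -> R) : Prop :=
  forall t, measurable_fun setT (xi t).

Definition indep_processes {d} {T : measurableType d} (P : probability T R)
  (n : nat) (xi : nat -> int -> T -> R) : Prop :=
  forall (ts : seq int) (Bs : nat -> nat -> set R),
    (forall i j, measurable (Bs i j)) ->
    P (\bigcap_(i in `I_n) cyl (xi i) ts (Bs i)) =
    (\prod_(i < n) P (cyl (xi i) ts (Bs i)))%E.

Definition frechet_marginals {d} {T : measurableType d} (P : probability T R)
  (xi : int -> T -> R) : Prop :=
  forall t (y : R), 0 < y -> P (xi t @^-1` `]-oo, y]) = (expR (- y^-1))%:E.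

Definition simple_max_stable {d} {T : measurableType d} (P : probability T R)
  (eta : int -> T -> R) : Prop :=
  frechet_marginals P eta /\
  forall (n : nat), (0 < n)%N ->
  forall d' (T' : measurableType d') (P' : probability T' R)
         (xi : nat -> int -> T' -> R),
    (forall i, is_process (xi i)) ->
    indep_processes P' n xi ->
    (forall i, (i < n)%N -> eqd P' (xi i) P eta) ->
    eqd P' (fun t w => n%:R^-1 * \big[Order.max/xi 0%N t w]_(i < n) xi i t w)
        P eta.

Definition stationary {d} {T : measurableType d} (P : probability T R)
  (eta : int -> T -> R) : Prop :=
  forall h : int, eqd P (fun t => eta (t + h)) P eta.

Definition past_sigma {d} {T : measurableType d} (eta : int -> T -> R) (t : int)
  : set (set T) :=
  <<s [set A | exists s B, s <= t /\ measurable B /\ A = eta s @^-1` B] >>.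

(* Markov property: P(eta(t+1) \in A | F_t) = phi(eta t) a.s. for some
   measurable phi, i.e. for every E in F_t,
   P({eta(t+1) \in A} /\ E) = \int_E phi(eta t) dP. *)
Definition markov_prop {d} {T : measurableType d} (P : probability T R)
  (eta : int -> T -> R) : Prop :=
  forall (t : int) (A : set R), measurable A ->
  exists phi : R -> R, measurable_fun setT phi /\
    forall E, past_sigma eta t E ->
      P (eta (t + 1) @^-1` A `&` E) = (\int[P]_(x in E) (phi (eta t x))%:E)%E.

Definition iid_frechet {d} {T : measurableType d} (P : probability T R)
  (F : int -> T -> R) : Prop :=
  is_process F /\ frechet_marginals P F /\
  forall (ns : seq int) (Bs : nat -> set R), uniq ns ->
    (forall i, measurable (Bs i)) ->
    P (cyl F ns Bs) = (\prod_(i < size ns) P (F (nth (0:int) ns i) @^-1` Bs i))%E.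

Definition maxAR {T : Type} (a : R) (F : int -> T -> R) : int -> T -> R :=
  fun t w => if a == 1 then F 0 w else
    fine (ereal_sup [set ((1 - a) * a ^+ `|t - n|%N * F n w)%:E | n in [set n | n <= t]]).

Definition rmaxAR {T : Type} (a : R) (F : int -> T -> R) : int -> T -> R :=
  fun t w => if a == 1 then F 0 w else
    fine (ereal_sup [set ((1 - a) * a ^+ `|n - t|%N * F n w)%:E | n in [set n | t <= n]]).

End Defs.

(* Main.v *)
Require Import Defs.
From HB Require Import structures.
From mathcomp Require Import all_boot all_order all_algebra.
From mathcomp Require Import all_classical all_reals all_analysis.
From mathcomp Require Import measurable_realfun.
From mathcomp Require Import ring lra zify.
Import Order.TTheory GRing.Theory Num.Theory.
Import numFieldNormedType.Exports.
Local Open Scope classical_set_scope.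
Local Open Scope ring_scope.
Set Implicit Arguments. Unset Strict Implicit. Unset Printing Implicit Defensive.

(* Let V(x,y,z) = -ln P(eta_{t-1} <= x, eta_t <= y, eta_{t+1} <= z), with x or z
   possibly omitted; max-stability makes V homogeneous of degree -1, and
   u |-> V(x,1/u,z) is convex and 1-Lipschitz.  Write fA(u) = V(X,1/u),
   fB(u) = V(1/u,Z), f3(u) = V(X,1/u,Z).  Conditional independence of eta_{t-1}
   and eta_{t+1} given eta_t, applied at the levels (X/l, 1/(l u), Z/l), reads
   f3' e^{-l f3} = fA' fB' e^{-l (fA + fB - u)} for all l > 0: wherever
   fA' fB' > 0, letting l -> oo gives f3 = fA + fB - u, letting l -> 0 gives
   f3' = fA' fB', and hence (1 - fA')(1 - fB') = 0.  Therefore one of the two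
   families of slopes is {0,1}-valued, which forces V(1/u,1) (or V(1,1/u)) to be
   max(u,a) + 1 - a, the bivariate law of X_a (or of its time reversal).
   The Markov property then propagates this to all finite-dimensional laws
   through the recursion satisfied by max-AR(1) processes. *)

(** * Slopes of the exponent functions *)

Section Slopes.
Context {R : realType}.

(** On an interval [v < u < w] the conditional probability of the future event is squeezed between
    constants, using [fB' <= 1] from above and [fB' >= k] from below; these integrated inequalities
    hold for all [l > 0] and survive both limits. The limit [l -> 0] yields only [f3' >= k fA'], but
    with [f3 = fA + fB - u] and [k = LB] this already reads [(1 - LA) (1 - LB) <= 0] for two slopes
    in [[0, 1]]. Slopes at unrelated points [X] and [Z] are brought to the common point [u = 1] by
    replacing [f u] with [f (X u) / X], which homogeneity permits; a positive slope stays positive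
    to the right, which is why the argument lives on [u >= 1]. Finally, the Markov property speaks
    only of the future given the past, so the time-reversed alternative needs its own way of
    propagating the bivariate law. *)

Fixpoint ratio (k : nat) : R := if k is k'.+1 then Num.sqrt (ratio k') else 2.

Lemma ratio_gt1 k : 1 < ratio k.
Proof.
elim: k => [|k IH] /=; first by lra.
by rewrite -[ltLHS]sqrtr1 ltr_sqrt// (lt_trans _ IH).
Qed.

Lemma ratio_sqr k : ratio k.+1 ^+ 2 = ratio k.
Proof. by rewrite /= sqr_sqrtr// ltW// (lt_trans _ (ratio_gt1 k)). Qed.

Lemma ratio_le k : ratio k <= 1 + (k.+1%:R)^-1.
Proof.
elim: k => [|k IH]; first by rewrite /=; lra.
have h := ratio_sqr k; have g1 := ratio_gt1 k.+1.
have hk : (0 : R) < k.+1%:R by rewrite ltr0n.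
rewrite leNgt; apply/negP => h1.
have e : 1 + (k.+1%:R : R)^-1 = (k.+2%:R) / k.+1%:R.
  by rewrite -[k.+2]addn1 natrD mulrDl mul1r mulfV// gt_eqF.
have hk2 : (0 : R) < k.+2%:R^-1 by rewrite invr_gt0 ltr0n.
have h2 : (1 + (k.+2%:R : R)^-1) ^+ 2 < 1 + (k.+1%:R)^-1.
  apply: lt_le_trans IH; rewrite -h.
  by move: (ratio k.+1) g1 h1 => r g1 h1; rewrite ltr_pXn2r ?nnegrE//; lra.
have h3 : (k.+1%:R : R)^-1 <= 2 * k.+2%:R^-1.
  rewrite ler_pdivlMr ?ltr0n// mulrC ler_pdivrMr//.
  by rewrite -!natr1; have := ler0n R k; lra.
by move: k.+1%:R^-1 k.+2%:R^-1 hk2 h2 h3 => b c; nra.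
Qed.

Lemma ratio_near1 (e : R) : 0 < e ->
  exists K, forall k, (K <= k)%N -> ratio k < 1 + e.
Proof.
move=> e0; exists (Num.truncn e^-1) => k hk.
apply: le_lt_trans (ratio_le k) _; rewrite ltrD2l invf_plt ?posrE ?ltr0n//.
by apply: lt_le_trans (truncnS_gt _) _; rewrite ler_nat.
Qed.

Lemma expr_floor (s x : R) : 1 < s -> 1 <= x ->
  exists m, s ^+ m <= x < s ^+ m.+1.
Proof.
move=> s1 x1.
have [n hn] : exists n, x < s ^+ n.
  have bern n : 1 + n%:R * (s - 1) <= s ^+ n.
    elim: n => [|n IH]; first by rewrite mul0r addr0 expr0.
    rewrite exprS -natr1.
    have h0 : 0 <= n%:R :> R by [].
    have h1 : 0 <= n%:R * (s - 1) ^+ 2 by rewrite mulr_ge0// sqr_ge0.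
    have h2 := ler_wpM2l (ltW (lt_trans ltr01 s1)) IH.
    by move: (s * s ^+ n) h1 h2 => p; lra.
  exists (Num.truncn ((x - 1) / (s - 1))).+1; apply: lt_le_trans (bern _).
  by rewrite -ltrBlDl -ltr_pdivrMr ?subr_gt0// truncnS_gt.
have ex : exists n, x < s ^+ n by exists n.
case: (ex_minnP ex) => -[|m] hm hmin; first by move: hm; rewrite expr0; lra.
exists m; rewrite hm andbT leNgt; apply/negP => /hmin.
by rewrite ltnn.
Qed.

(* The last condition says that u |-> f (exp u) has increments growing at
   least exponentially; together with monotonicity it amounts to convexity. *)
Definition scale_convex (f : R -> R) :=
  [/\ forall u v, 0 < u -> u <= v -> f u <= f v,
      forall u v, 0 < u -> u <= v -> f v - f u <= v - u &
      forall s u v, 1 <= s -> 0 < u -> u <= v ->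
        s * (f v - f u) <= f (s * v) - f (s * u)].

(** The right derivative at [v], as both the limit and a lower bound of secant slopes over
    [[v, v * ratio k]]. The steps [ratio k = 2^(2^-k)] suit scale convexity: each is the square of
    the next, so consecutive secants are compared by a single dilation. *)
Definition right_slope (f : R -> R) (v L : R) :=
  [/\ 0 <= L <= 1,
      forall k, L * (v * (ratio k - 1)) <= f (v * ratio k) - f v &
      forall e, 0 < e -> exists K, forall k, (K <= k)%N ->
        f (v * ratio k) - f v <= (L + e) * (v * (ratio k - 1))].

(** The secant slopes decrease in [k]: for [r = ratio k.+1], dilating [[v, v r]] by [r] gives [f (v
    r^2) - f v >= (r + 1) (f (v r) - f v)], while [r^2 - 1 = (r + 1) (r - 1)]. Their infimum is
    therefore their limit. *)
Lemma right_slope_ex (f : R -> R) (v : R) : scale_convex f -> 0 < v ->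
  exists L, right_slope f v L.
Proof.
move=> [fm fl fs] v0.
have d0 k : 0 < v * (ratio k - 1) by rewrite mulr_gt0// subr_gt0 ratio_gt1.
have vr k : v <= v * ratio k by rewrite ler_peMr// ltW// ratio_gt1.
pose S k := (f (v * ratio k) - f v) / (v * (ratio k - 1)).
have S0 k : 0 <= S k by apply: divr_ge0; [rewrite subr_ge0 fm | exact: ltW].
have S1 k : S k <= 1.
  by rewrite ler_pdivrMr// mul1r mulrBr mulr1 fl.
have Sdecr k : S k.+1 <= S k.
  have r1 := ratio_gt1 k.+1; have rk := ratio_sqr k.
  rewrite /S ler_pdivrMr// mulrAC ler_pdivlMr//.
  have := fs (ratio k.+1) v (v * ratio k.+1) (ltW r1) v0 (vr _).
  have -> : ratio k.+1 * (v * ratio k.+1) = v * ratio k.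
    by rewrite -rk expr2; ring.
  rewrite -rk [ratio k.+1 * v]mulrC => h.
  set a := f (v * ratio k.+1 ^+ 2) in h *; set b := f (v * ratio k.+1) in h *.
  set c := f v in h *; set r := ratio k.+1 in r1 h *.
  have -> : (b - c) * (v * (r ^+ 2 - 1)) = ((r + 1) * (b - c)) * (v * (r - 1)).
    by ring.
  by rewrite ler_pM2r; [nra | exact: d0].
have Sd k l : (k <= l)%N -> S l <= S k.
  by move=> kl; rewrite -(subnK kl); elim: (l - k)%N => // n IH; exact: le_trans (Sdecr _) IH.
have hi : has_inf (range S).
  by split; [exists (S 0%N); exists 0%N | exists 0 => _ [k _ <-]].
have lb k : inf (range S) <= S k by apply: ge_inf; [case: hi | exists k].
exists (inf (range S)); split.
- apply/andP; split; last exact: le_trans (lb 0%N) (S1 _).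
  by apply: lb_le_inf; [case: hi | move=> _ [k _ <-]].
- by move=> k; rewrite -ler_pdivlMr//; exact: lb.
- move=> e e0; have [_ [K _ <-] hK] := inf_adherent e0 hi.
  exists K => k Kk; rewrite -ler_pdivrMr//.
  exact: le_trans (Sd _ _ Kk) (ltW hK).
Qed.

(** A geometric step starting to the right of [v] is a dilation of the step at [v], so it inherits
    the slope bound; such steps are chained from [w] and then refined. *)
Lemma right_slope_right (f : R -> R) (v L : R) :
  scale_convex f -> 0 < v -> right_slope f v L ->
  forall w w', v <= w -> w <= w' -> L * (w' - w) <= f w' - f w.
Proof.
move=> [fm fl fs] v0 [/andP[L0 L1] hL _] w w' vw ww'.
have w0 : 0 < w by exact: lt_le_trans vw.
have step k j : L * (w * ratio k ^+ j - w) <= f (w * ratio k ^+ j) - f w.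
  have r1 := ratio_gt1 k.
  elim: j => [|j IH]; first by rewrite expr0 mulr1 !subrr mulr0.
  have pj : 1 <= ratio k ^+ j by rewrite exprn_ege1// ltW.
  pose s := w * ratio k ^+ j / v.
  have s1 : 1 <= s.
    by rewrite ler_pdivlMr// mul1r (le_trans vw)// ler_peMr// ltW.
  have vr : v <= v * ratio k by rewrite ler_peMr// ltW.
  have := fs s v (v * ratio k) s1 v0 vr.
  have -> : s * v = w * ratio k ^+ j by rewrite /s divfK// gt_eqF.
  have -> : s * (v * ratio k) = w * ratio k ^+ j.+1.
    by rewrite mulrA /s divfK ?gt_eqF// exprSr mulrA.
  have hk := ler_wpM2l (le_trans ler01 s1) (hL k).
  have e : s * (L * (v * (ratio k - 1))) =
      L * (w * ratio k ^+ j.+1 - w * ratio k ^+ j).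
    have -> : s * (L * (v * (ratio k - 1))) = s * v * (L * (ratio k - 1)) by ring.
    by rewrite /s divfK ?gt_eqF// exprSr; ring.
  rewrite e in hk => h; move: (le_trans hk h) IH; lra.
(* The largest [w * ratio k ^+ m] not above [w'] exceeds [w' / ratio k]; monotonicity of [f] covers
   the remaining gap. *)
have key k : L * (w' / ratio k - w) <= f w' - f w.
  have r1 := ratio_gt1 k.
  have := @expr_floor (ratio k) (w' / w) r1.
  rewrite ler_pdivlMr// mul1r => /(_ ww')[m /andP[]].
  rewrite ler_pdivlMr// ltr_pdivrMr// => h1 h2.
  apply: le_trans (le_trans (step k m) _).
    apply: ler_wpM2l => //; rewrite lerB// ler_pdivrMr ?(lt_trans _ r1)//.
    by rewrite -mulrA -exprSr mulrC ltW.
  rewrite lerB// fm ?mulr_gt0 ?exprn_gt0 ?(lt_trans _ r1)//.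
  by rewrite mulrC.
apply/ler_addgt0Pr => e e0.
have w'0 : 0 < w' by exact: lt_le_trans ww'.
have [K hK] := ratio_near1 (divr_gt0 e0 w'0).
have := hK K (leqnn _); have r1 := ratio_gt1 K; have := key K.
set r := ratio K in r1 *;
move=> h1 h2.
have h3 : w' / r >= w' - e.
  rewrite ler_pdivlMr; last by lra.
  have h4 : w' * (r - 1) < e.
    by move: h2; rewrite -ltrBlDl ltr_pdivlMr// mulrC.
  nra.
nra.
Qed.

(** Here a step starting at [x <= v] is dilated by [v / x] onto the step at [v], which bounds its
    slope from above. The chain must cover [w'] and overshoots it by at most a factor [ratio k]. *)
Lemma right_slope_left (f : R -> R) (v L : R) :
  scale_convex f -> 0 < v -> right_slope f v L ->
  forall w w', 0 < w -> w <= w' -> w' <= v -> f w' - f w <= L * (w' - w).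
Proof.
move=> [fm fl fs] v0 [/andP[L0 L1] _ hL] w w' w0 ww' w'v.
have step k M j : f (v * ratio k) - f v <= M * (v * (ratio k - 1)) ->
    w * ratio k ^+ j <= v ->
    f (w * ratio k ^+ j.+1) - f w <= M * (w * ratio k ^+ j.+1 - w).
  move=> hM; have r1 := ratio_gt1 k.
  have one x : 0 < x -> x <= v -> f (x * ratio k) - f x <= M * (x * ratio k - x).
    move=> x0 xv; have s1 : 1 <= v / x by rewrite ler_pdivlMr// mul1r.
    have xr : x <= x * ratio k by rewrite ler_peMr// ltW.
    have := fs (v / x) x (x * ratio k) s1 x0 xr.
    rewrite mulrA divfK ?gt_eqF// => h.
    have := ler_wpM2l (ltW x0) (le_trans h hM).
    have -> : x * (v / x * (f (x * ratio k) - f x)) = v * (f (x * ratio k) - f x).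
      by rewrite mulrA mulrCA divff ?gt_eqF// mulr1.
    have -> : x * (M * (v * (ratio k - 1))) = v * (M * (x * ratio k - x)) by ring.
    by rewrite ler_pM2l.
  elim: j => [|j IH] hj; first by rewrite expr1; apply: one; rewrite // -[w]mulr1.
  have hj' : w * ratio k ^+ j <= v.
    apply: le_trans hj; rewrite exprSr mulrA ler_peMr ?mulr_ge0 ?exprn_ge0 ?ltW//.
    exact: lt_trans r1.
  have := one _ _ hj; rewrite -mulrA -exprSr => /(_ _).
  have p0 : 0 < w * ratio k ^+ j.+1 by rewrite mulr_gt0// exprn_gt0// (lt_trans _ r1).
  move=> /(_ p0); have := IH hj'; lra.
have key k M : 0 <= M -> f (v * ratio k) - f v <= M * (v * (ratio k - 1)) ->
    f w' - f w <= M * (w' * ratio k - w).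
  move=> M0 hM; have r1 := ratio_gt1 k.
  have := @expr_floor (ratio k) (w' / w) r1.
  rewrite ler_pdivlMr// mul1r => /(_ ww')[m /andP[]].
  rewrite ler_pdivlMr// ltr_pdivrMr// => h1 h2.
  apply: le_trans (le_trans _ (step k M m hM _)) _.
  - rewrite lerB// fm ?(lt_le_trans w0)//.
    by rewrite mulrC ltW.
  - by rewrite mulrC (le_trans h1).
  - apply: ler_wpM2l => //; rewrite lerB// exprSr mulrA ler_pM2r ?(lt_trans _ r1)//.
    by rewrite mulrC.
apply/ler_addgt0Pr => e e0.
(* Three error terms, each at most [w' * d], have to add up to at most [e]. *)
pose d := Num.min 1 (e / (3 * w')).
have w'0 : 0 < w' by exact: lt_le_trans ww'.
have d0 : 0 < d by rewrite lt_min ltr01/= divr_gt0// mulr_gt0.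
have [K1 h1] := ratio_near1 d0; have [K2 h2] := hL _ d0.
pose k := maxn K1 K2.
have r1 := ratio_gt1 k.
have Ld : 0 <= L + d by lra.
have := key k (L + d) Ld (h2 k (leq_maxr _ _)).
have := h1 k (leq_maxl _ _).
have de : d * (3 * w') <= e by rewrite -ler_pdivlMr ?mulr_gt0// ge_min lexx orbT.
have dle1 : d <= 1 by rewrite ge_min lexx.
set r := ratio k in r1 *; move=> hr hf.
apply: le_trans hf _.
have q1 : w' * r <= w' + w' * d by nra.
have q2 : (L + d) * (w' * r - w) <= (L + d) * (w' + w' * d - w) by rewrite ler_wpM2l// lerB.
have q3 : L * (w' * d) <= w' * d by rewrite ler_piMl// mulr_ge0// ltW.
have q4 : d * (w' * d) <= w' * d by rewrite ler_piMl// mulr_ge0// ltW.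
have q5 : 0 <= d * w by rewrite mulr_ge0// ltW.
apply: le_trans q2 _; nra.
Qed.

(** As [f] is 1-Lipschitz, [h u = u + 1 - f u] is nondecreasing, and [a] is its limit at infinity. A
    slope 0 at [v] makes [f] constant on []0, v]], with the value 1 that the bounds impose near 0; a
    slope 1 makes [h] constant from [v] on, so [f v = v + 1 - a]. *)
Lemma zero_one_slopes_max_affine (f : R -> R) : scale_convex f ->
  (forall u, 0 < u -> Num.max u 1 <= f u <= u + 1) ->
  (forall v L, 0 < v -> right_slope f v L -> L = 0 \/ L = 1) ->
  exists a, 0 <= a <= 1 /\ forall u, 0 < u -> f u = Num.max u a + 1 - a.
Proof.
move=> fsc fb f01.
have fb' u : 0 < u -> [/\ u <= f u, 1 <= f u & f u <= u + 1].
  by move=> /fb; rewrite ge_max => /andP[/andP[]].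
pose h u := u + 1 - f u.
pose S := [set h u | u in [set u | 0 < u]].
have hsup : has_sup S.
  split; first by exists (h 1), 1 => /=; rewrite ?ltr01.
  by exists 1 => _ [u /= /fb'[u1 u2 u3] <-]; rewrite /h; lra.
have [fm fl fs] := fsc.
have hub u : 0 < u -> h u <= sup S by move=> u0; apply: sup_upper_bound => //; exists u.
exists (sup S); split.
  apply/andP; split.
    by apply: le_trans (hub 1 _) => //; have [] := fb' 1 ltr01; rewrite /h; lra.
  by apply: sup_le_ub; [case: hsup | move=> _ [u /= /fb'[u1 u2 u3] <-]; rewrite /h; lra].
move=> v v0; have [L hL] := right_slope_ex fsc v0.
have [b1 b2 b3] := fb' _ v0.
have hv := hub _ v0.
case: (f01 _ _ v0 hL) => L01; subst L.
  have f1 : f v = 1.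
    apply/eqP; rewrite eq_le b2 andbT; apply/ler_addgt0Pr => e e0.
    pose w := Num.min e v.
    have w0 : 0 < w by rewrite lt_min e0.
    have wv : w <= v by rewrite ge_min lexx orbT.
    have := right_slope_left fsc v0 hL w0 wv (lexx _).
    have [_ _ +] := fb' _ w0.
    have : w <= e by rewrite ge_min lexx.
    lra.
  by rewrite max_r; move: hv; rewrite /h f1; lra.
have hle : sup S <= h v.
  apply: sup_le_ub; first by case: hsup.
  move=> _ [u /= u0 <-]; have [uv|vu] := leP u v.
    by have := fl _ _ u0 uv; rewrite /h; lra.
  by have := right_slope_right fsc v0 hL (lexx _) (ltW vu); rewrite /h; lra.
by rewrite max_l; move: hv hle; rewrite /h; lra.
Qed.

(** * Exponential estimates and the limits in [l] *)

Lemma expRN_sub_ge (l a b : R) :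
  l * (b - a) * expR (- l * b) <= expR (- l * a) - expR (- l * b).
Proof.
have -> : - l * a = l * (b - a) + - l * b by ring.
rewrite expRD; have := expR_ge1Dx (l * (b - a)); have := expR_ge0 (- l * b).
nra.
Qed.

Lemma expRN_sub_le (l a b : R) :
  expR (- l * a) - expR (- l * b) <= l * (b - a) * expR (- l * a).
Proof.
have -> : - l * b = - (l * (b - a)) + - l * a by ring.
rewrite expRD; have := expR_ge1Dx (- (l * (b - a))); have := expR_ge0 (- l * a).
nra.
Qed.

Lemma expRN_small (k e d : R) : 0 < k -> 0 < e -> 0 < d ->
  exists l, 0 < l /\ expR (- l * e) < k * (1 - expR (- l * d)).
Proof.
move=> k0 e0 d0.
have expN (x : R) : 0 <= x -> expR (- x) <= (1 + x)^-1.
  by move=> x0; rewrite expRN lef_pV2 ?expR_ge1Dx// posrE ?expR_gt0//; lra.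
(* The first summand gives [l d >= 1], so that [1 - exp (- l d) >= 1/2]; the second gives
   [l e >= 2 / k], so that [exp (- l e) < k / 2]. *)
pose l := d^-1 + 2 / (k * e).
have l0 : 0 < l by rewrite addr_gt0 ?invr_gt0// divr_gt0// mulr_gt0.
exists l; split => //.
have ld : 1 <= l * d.
  by rewrite mulrDl mulVf ?gt_eqF// lerDl mulr_ge0 ?divr_ge0 ?mulr_ge0// ltW.
have le : 2 / k <= l * e.
  have -> : l * e = d^-1 * e + 2 / k by rewrite /l; field; rewrite !gt_eqF.
  by rewrite lerDr mulr_ge0 ?invr_ge0// ltW.
have h1 : expR (- l * d) <= 2^-1.
  have ld0 : 0 <= l * d by lra.
  rewrite mulNr; apply: (le_trans (expN _ ld0)).
  by rewrite lef_pV2 ?posrE//; lra.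
have h2 : expR (- l * e) < k / 2.
  have k2 : 0 < 2 / k by rewrite divr_gt0.
  have le0 : 0 <= l * e by lra.
  rewrite mulNr; apply: (le_lt_trans (expN _ le0)).
  by rewrite -[k / 2]invrK invf_div ltf_pV2 ?posrE//; lra.
have h3 : k * expR (- l * d) <= k * 2^-1 by rewrite ler_pM2l.
lra.
Qed.

Section MarkovSlopes.
Variables (fA fB f3 : R -> R) (kA k : R).
Hypotheses (kA0 : 0 < kA) (k0 : 0 < k).
Hypothesis lowA : forall v w, 1 <= v -> v <= w -> kA * (w - v) <= fA w - fA v.
Hypothesis lipB : forall v w, 1 <= v -> v <= w -> fB w - fB v <= w - v.
(** [upper] and [lower] integrate [f3' e^{-l f3} = fA' e^{-l fA} fB' e^{l (u - fB)}] over
    [v < u < w], with the last factor [fB' e^{l (u - fB)}] replaced by its extreme values: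
    [fB' <= 1] in [upper], [fB' >= k] in [lower]. *)
Hypothesis upper : forall l v w, 0 < l -> 1 <= v -> v < w ->
  expR (- l * f3 v) - expR (- l * f3 w) <=
  expR (l * (w - fB v)) * (expR (- l * fA v) - expR (- l * fA w)).
Hypothesis lower : forall l v w, 0 < l -> 1 <= v -> v < w ->
  k * expR (l * (v - fB w)) * (expR (- l * fA v) - expR (- l * fA w)) <=
  expR (- l * f3 v) - expR (- l * f3 w).

Let dA0 v w : 1 <= v -> v < w -> 0 < fA w - fA v.
Proof.
move=> v1 vw; apply: lt_le_trans (lowA v1 (ltW vw)).
by rewrite mulr_gt0// subr_gt0.
Qed.

Let d30 v w : 1 <= v -> v < w -> 0 < f3 w - f3 v.
Proof.
move=> v1 vw; have := lower ltr01 v1 vw.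
have h : 0 < expR (- 1 * fA v) - expR (- 1 * fA w).
  by rewrite subr_gt0 ltr_expR; have := dA0 v1 vw; lra.
have h2 : 0 < k * expR (1 * (v - fB w)) by rewrite mulr_gt0// expR_gt0.
move=> h3; have : 0 < expR (- 1 * f3 v) - expR (- 1 * f3 w).
  by apply: lt_le_trans h3; rewrite mulr_gt0.
by rewrite subr_gt0 ltr_expR; lra.
Qed.

(** Otherwise [lower] on [[v, v + e]], divided by [E], gives [k (1 - exp (- l dA)) <= exp (- l g)],
    where [dA] is the positive increment of [fA] and [g > 0] does not depend on [l]: impossible for
    large [l]. *)
Let f3_le v : 1 <= v -> f3 v <= fA v + fB v - v.
Proof.
move=> v1; apply/ler_addgt0Pr => e e0.
have vw : v < v + e by rewrite ltrDl.
apply: (@le_trans _ _ (fA v + fB (v + e) - v)); last first.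
  by have := lipB v1 (ltW vw); lra.
rewrite leNgt; apply/negP; rewrite -subr_gt0 => g0.
set g := (X in 0 < X) in g0.
have [l [l0]] := expRN_small k0 g0 (dA0 v1 vw); apply/negP; rewrite -leNgt.
have := lower l0 v1 vw.
set E := expR (l * (v - fB (v + e) - fA v)).
have E0 : 0 < E by exact: expR_gt0.
have -> : expR (- l * fA (v + e)) =
    expR (- l * fA v) * expR (- l * (fA (v + e) - fA v)).
  by rewrite -expRD; congr expR; ring.
have -> : k * expR (l * (v - fB (v + e))) *
   (expR (- l * fA v) - expR (- l * fA v) * expR (- l * (fA (v + e) - fA v))) =
   E * (k * (1 - expR (- l * (fA (v + e) - fA v)))).
  have -> : E = expR (l * (v - fB (v + e))) * expR (- l * fA v).
    by rewrite -expRD; congr expR; ring.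
  by ring.
have -> : expR (- l * f3 v) = E * expR (- l * g).
  by rewrite -expRD /g; congr expR; ring.
move=> h; rewrite -(ler_pM2l E0); apply: le_trans h _.
by rewrite lerBlDr lerDl expR_ge0.
Qed.

(** The same contradiction at large [l], now from [upper] and the positive increment of [f3]. *)
Let f3_ge v : 1 <= v -> fA v + fB v - v <= f3 v.
Proof.
move=> v1; apply/ler_addgt0Pr => e e0.
have vw : v < v + e by rewrite ltrDl.
rewrite leNgt; apply/negP => g0'.
have g0 : 0 < fA v + fB v - (v + e) - f3 v by lra.
set g := (X in 0 < X) in g0.
have [l [l0]] := expRN_small ltr01 g0 (d30 v1 vw); apply/negP; rewrite -leNgt.
have := upper l0 v1 vw.
set E := expR (- l * f3 v).
have E0 : 0 < E by exact: expR_gt0.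
have -> : expR (- l * f3 (v + e)) = E * expR (- l * (f3 (v + e) - f3 v)).
  by rewrite -expRD; congr expR; ring.
move=> h; rewrite mul1r -(ler_pM2l E0) mulrBr mulr1; apply: le_trans h _.
have -> : E * expR (- l * g) = expR (l * (v + e - fB v)) * expR (- l * fA v).
  by rewrite -!expRD /g; congr expR; ring.
by rewrite ler_pM2l ?expR_gt0// lerBlDr lerDl expR_ge0.
Qed.

(** Once [f3 = fA + fB - u], the right-hand side is the increment of [f3]; dividing [lower] by [l]
    and letting [l -> 0] bounds it below by [k] times the increment of [fA]. *)
Lemma markov_slopes v w : 1 <= v -> v < w ->
  k * (fA w - fA v) <= (fA w - fA v) + (fB w - fB v) - (w - v).
Proof.
move=> v1 vw; have w1 : 1 <= w by exact: le_trans (ltW vw).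
have e3 x : 1 <= x -> f3 x = fA x + fB x - x.
  by move=> x1; apply/eqP; rewrite eq_le f3_le// f3_ge.
have -> : (fA w - fA v) + (fB w - fB v) - (w - v) = f3 w - f3 v.
  by rewrite !e3//; ring.
set dA := fA w - fA v; set d3 := f3 w - f3 v.
(* The exponent that remains after the common factor [l * exp (- l * f3 v)] is divided out; it is
   harmless as [l -> 0]. *)
pose c := v - fB w - fA w + f3 v.
have hA : 0 < dA by exact: dA0.
have key l : 0 < l -> k * dA * (1 + l * c) <= d3.
  move=> l0; have h1 := lower l0 v1 vw.
  have h2 := expRN_sub_le l (f3 v) (f3 w).
  have h3 := expRN_sub_ge l (fA v) (fA w).
  have p0 : 0 <= k * expR (l * (v - fB w)) by rewrite mulr_ge0 ?expR_ge0// ltW.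
  have := le_trans (ler_wpM2l p0 h3) (le_trans h1 h2).
  have -> : k * expR (l * (v - fB w)) * (l * (fA w - fA v) * expR (- l * fA w))
     = (l * expR (- l * f3 v)) * (k * dA * expR (l * c)).
    have -> : expR (l * c) =
        expR (l * (v - fB w)) * expR (- l * fA w) * expR (l * f3 v).
      by rewrite -!expRD /c; congr expR; ring.
    have h0 : expR (- l * f3 v) * expR (l * f3 v) = 1.
      by rewrite -expRD -[RHS]expR0; congr expR; ring.
    rewrite -[LHS]mulr1 -h0 /dA; ring.
  have -> : l * (f3 w - f3 v) * expR (- l * f3 v) =
     (l * expR (- l * f3 v)) * d3 by rewrite /d3; ring.
  rewrite ler_pM2l ?mulr_gt0 ?expR_gt0// => h; apply: le_trans h.
  by rewrite ler_pM2l ?mulr_gt0// expR_ge1Dx.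
apply/ler_addgt0Pr => e e0.
have ca : 0 < `|k * dA * c| + 1 by rewrite ltr_wpDl.
have l0 : 0 < e / (`|k * dA * c| + 1) by rewrite divr_gt0.
have := key _ l0; set l := e / _.
have : `|l * (k * dA * c)| <= e.
  rewrite normrM gtr0_norm// /l mulrAC ler_pdivrMr// ler_pM2l// lerDl.
  exact: ler01.
by rewrite ler_norml => /andP[] + _; lra.
Qed.

End MarkovSlopes.

Lemma markov_slope_dichotomy (fA fB f3 : R -> R) (X Z LA LB : R) :
  scale_convex fA -> scale_convex fB -> 0 < X -> 0 < Z ->
  right_slope fA X LA -> right_slope fB Z LB ->
  (forall l v w, 0 < l -> 1 <= v -> v < w ->
    expR (- l * f3 v) - expR (- l * f3 w) <=
    expR (l * (w - fB (Z * v) / Z)) *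
      (expR (- l * (fA (X * v) / X)) - expR (- l * (fA (X * w) / X)))) ->
  (forall k l v w, 0 <= k -> 0 < l -> 1 <= v -> v < w ->
    (forall x y, v <= x -> x <= y ->
      k * (y - x) <= fB (Z * y) / Z - fB (Z * x) / Z) ->
    k * expR (l * (v - fB (Z * w) / Z)) *
      (expR (- l * (fA (X * v) / X)) - expR (- l * (fA (X * w) / X))) <=
    expR (- l * f3 v) - expR (- l * f3 w)) ->
  0 < LA -> 0 < LB -> LA = 1 \/ LB = 1.
Proof.
move=> sA sB X0 Z0 rA rB MU ML LA0 LB0.
have low f L Y : scale_convex f -> 0 < Y -> right_slope f Y L ->
    forall v w, 1 <= v -> v <= w -> L * (w - v) <= f (Y * w) / Y - f (Y * v) / Y.
  move=> sf Y0 rf v w v1 vw; rewrite -mulrBl ler_pdivlMr// -mulrA.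
  rewrite [_ * Y]mulrC mulrBr; apply: (right_slope_right sf Y0 rf).
    by rewrite ler_peMr// ltW.
  by rewrite ler_pM2l.
have lip v w : 1 <= v -> v <= w -> fB (Z * w) / Z - fB (Z * v) / Z <= w - v.
  move=> v1 vw; rewrite -mulrBl ler_pdivrMr// [_ * Z]mulrC mulrBr.
  have [_ fl _] := sB; apply: fl; last by rewrite ler_pM2l.
  by rewrite mulr_gt0//; lra.
have key := @markov_slopes (fun v => fA (X * v) / X) (fun v => fB (Z * v) / Z) f3
  LA LB LA0 LB0 (low _ _ _ sA X0 rA) lip MU.
have {}key := key (fun l v w l0 v1 vw => ML LB l v w (ltW LB0) l0 v1 vw
  (fun x y vx xy => low _ _ _ sB Z0 rB x y (le_trans v1 vx) xy)).
have [/andP[_ LA1] _ uA] := rA; have [/andP[_ LB1] _ uB] := rB.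
have [->|nA] := eqVneq LA 1; first by left.
have [->|nB] := eqVneq LB 1; first by right.
exfalso.
have {}LA1 : LA < 1 by rewrite lt_neqAle nA.
have {}LB1 : LB < 1 by rewrite lt_neqAle nB.
(* The product [(1 - LA) (1 - LB)] equals [4 e], whereas [key] between 1 and [ratio j] bounds it by
   [2 e]. *)
pose e := (1 - LA) * (1 - LB) / 4.
have e0 : 0 < e by rewrite divr_gt0// mulr_gt0// subr_gt0.
have [K1 h1] := uA _ e0; have [K2 h2] := uB _ e0.
pose j := maxn K1 K2; have r1 := ratio_gt1 j.
have := key 1 (ratio j) (lexx _) r1.
have := h1 j (leq_maxl _ _); have := h2 j (leq_maxr _ _).
rewrite !mulr1.
have norm f Y L : 0 < Y -> f (Y * ratio j) - f Y <= (L + e) * (Y * (ratio j - 1)) ->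
    f (Y * ratio j) / Y - f Y / Y <= (L + e) * (ratio j - 1).
  by move=> Y0 h; rewrite -mulrBl ler_pdivrMr// -mulrA [_ * Y]mulrC.
move=> /(norm fB _ _ Z0) hB /(norm fA _ _ X0) hA.
set a := fA (X * ratio j) / X - fA X / X in hA *.
set b := fB (Z * ratio j) / Z - fB Z / Z in hB *.
set r := ratio j in r1 hA hB *; move=> h.
have r0 : 0 < r - 1 by lra.
have h3 : (1 - LB) * a <= (1 - LB) * ((LA + e) * (r - 1)).
  by rewrite ler_pM2l//; lra.
have h4 : 0 <= (r - 1) * (LB + e - 1 + (1 - LB) * (LA + e)) by nra.
rewrite pmulr_rge0// in h4.
have : (1 - LB) * e <= e by rewrite ler_piMl// ?ltW//; lra.
have : 4 * e = (1 - LA) * (1 - LB) by rewrite /e; field.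
nra.
Qed.

End Slopes.

(** * The Markov property as a comparison of measures *)

Section MeasuresOnR.
Context {R : realType}.
Local Open Scope ereal_scope.

Lemma finite_measure_fin_num (m : {measure set (measurableTypeR R) -> \bar R}) :
  m setT < +oo -> forall A, measurable A -> m A \is a fin_num.
Proof.
move=> fm B mB; rewrite ge0_fin_numE//; apply: le_lt_trans fm.
by apply: le_measure; rewrite ?inE.
Qed.

Lemma measure_ocitv (m : {measure set (measurableTypeR R) -> \bar R}) (a b : R) :
  m setT < +oo -> (a <= b)%R ->
  m `]a, b]%classic = (fine (m `]-oo, b]%classic) - fine (m `]-oo, a]%classic))%:E.
Proof.
move=> fm ab.
have mitv (i : interval R) :
    measurable ([set` i] : set (measurableTypeR R)) by exact: measurable_itv.
have -> : `]-oo, b]%classic = `]-oo, a]%classic `|` `]a, b]%classic.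
  by rewrite -itv_bndbnd_setU ?bnd_simp.
rewrite measureU//; last first.
  apply/seteqP; split => x //=; rewrite !in_itv/= => -[xa /andP[ax _]].
  by move: (lt_le_trans ax xa); rewrite ltxx.
rewrite fineD ?finite_measure_fin_num// addrAC subrr add0r fineK//.
exact: finite_measure_fin_num.
Qed.

(* m2 - m1 is realised as the Lebesgue-Stieltjes measure of the difference of
   the distribution functions. *)
Lemma measure_le_ocitv (m1 m2 : {measure set (measurableTypeR R) -> \bar R}) :
  m1 setT < +oo -> m2 setT < +oo ->
  (forall a b, (a < b)%R -> m1 `]a, b]%classic <= m2 `]a, b]%classic) ->
  forall A, measurable A -> m1 A <= m2 A.
Proof.
move=> f1 f2 m12 A mA.
have mitv (i : interval R) :
    measurable ([set` i] : set (measurableTypeR R)) by exact: measurable_itv.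
have fin := finite_measure_fin_num; have split_oc := measure_ocitv.
pose F (x : R) : R := (fine (m2 `]-oo, x]%classic) - fine (m1 `]-oo, x]%classic))%R.
have Fnd : nondecreasing F.
  move=> a b; rewrite le_eqVlt => /orP[/eqP->//|ab].
  have := m12 _ _ ab; rewrite (split_oc m1 _ _ f1 (ltW ab)).
  by rewrite (split_oc m2 _ _ f2 (ltW ab)) lee_fin /F; lra.
(* Monotonicity provides a right limit, which is identified along [a + 1 / (n + 1)] by continuity
   from above of both measures. *)
have Frc : forall a : R, F x @[x --> a^'+] --> F a.
  move=> a.
  have cvgF : F x @[x --> a^'+] --> inf [set F x | x in `]a, (a + 1)%R]%classic].
    apply: nondecreasing_at_right_cvgr; first by rewrite bnd_simp ltrDl.
      by move=> x y _ _; exact: Fnd.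
    by exists (F a) => _ [x /= xa <-]; apply/Fnd/ltW; move: xa; rewrite in_itv/= => /andP[].
  have cvgs : (fun n => F (a + n.+1%:R^-1)%R) @ \oo -->
      inf [set F x | x in `]a, (a + 1)%R]%classic].
    have /cvg_at_rightP := cvgF; apply; split => [n|]; first by rewrite ltrDl.
    rewrite -[X in _ --> X]addr0; apply: (@cvgD _ R^o); first exact: cvg_cst.
    exact: (@cvg_harmonic R).
  have cvgm (m : {measure set (measurableTypeR R) -> \bar R}) : m setT < +oo ->
      (fun n => fine (m `]-oo, (a + n.+1%:R^-1)%R]%classic)) @ \oo -->
      fine (m `]-oo, a]%classic).
    move=> fm; apply: fine_cvg; rewrite fineK ?fin//.
    rewrite (_ : `]-oo, a]%classic =
        \bigcap_n `]-oo, (a + n.+1%:R^-1)%R]%classic); last first.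
      by rewrite -itvNycEbigcap.
    apply: (@nonincreasing_cvg_mu _ _ _ m
      (fun n => `]-oo, (a + n.+1%:R^-1)%R]%classic)) => //.
    - by rewrite -ge0_fin_numE// fin.
    - exact: bigcap_measurable.
    - move=> p q pq; apply/subsetPset; apply: subset_itvl.
      by rewrite bnd_simp lerD2l lef_pV2 ?posrE// ler_nat.
  have cvga : (fun n => F (a + n.+1%:R^-1)%R) @ \oo --> F a.
    by apply: cvgB; exact: cvgm.
  by rewrite -(cvg_unique _ cvgs cvga).
pose cF := isCumulative.Build R _ R F Fnd Frc.
pose FF : cumulative R R := HB.pack F cF.
have lsE a b : (a <= b)%R ->
    lebesgue_stieltjes_measure FF `]a, b]%classic = (F b - F a)%:E.
  move=> ab; rewrite -[RHS](@wlength_itv_bnd _ FF _ _ false false ab).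
  by apply: measurable_mu_extE; exact: is_ocitv.
have key B : measurable B -> lebesgue_stieltjes_measure FF B + m1 B = m2 B.
  move=> mB; rewrite -measure_addE.
  apply: (@measure_unique _ R (measurableTypeR R) (@ocitv R)
    (fun n => `](- n%:R)%R, n%:R%R]%classic) erefl _ _ _
    (measure_add (lebesgue_stieltjes_measure FF) m1) m2) => //.
  - exact: ocitvI.
  - by move=> n; exists ((- n%:R)%R, n%:R%R).
  - rewrite -subTset => x _; exists (Num.truncn `|x|).+1 => //=; rewrite in_itv/=.
    have := truncnS_gt `|x|%R; set n := (Num.truncn _).+1 => xn.
    by move: xn; rewrite ltr_norml => /andP[-> /ltW].
  - move=> _ [[x y] _ <-]; rewrite [_.1]/= [_.2]/=; have [xy|yx] := leP x y; last first.
      by rewrite set_itv_ge ?measure0// bnd_simp -leNgt ltW.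
    transitivity (lebesgue_stieltjes_measure FF `]x, y]%classic + m1 `]x, y]%classic).
      exact: measure_addE.
    rewrite lsE// (split_oc m1 _ _ f1 xy) (split_oc m2 _ _ f2 xy).
    by rewrite -EFinD /F; congr (_%:E); lra.
  - move=> n; have nn : (- n%:R <= n%:R :> R)%R by rewrite (le_trans _ (ler0n _ n))// oppr_le0.
    apply: (@le_lt_trans _ _ (lebesgue_stieltjes_measure FF
      `](- n%:R)%R, n%:R]%classic + m1 `](- n%:R)%R, n%:R]%classic)).
      by rewrite le_eqVlt; apply/orP; left; apply/eqP; exact: measure_addE.
    by rewrite lsE// (split_oc m1 _ _ f1 nn) -EFinD ltry.
by rewrite -(key _ mA) leeDr.
Qed.

Lemma measure_eq_halflines (m1 m2 : {measure set (measurableTypeR R) -> \bar R}) :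
  m1 setT < +oo -> m2 setT < +oo ->
  (forall z, m1 `]-oo, z]%classic = m2 `]-oo, z]%classic) ->
  forall A, measurable A -> m1 A = m2 A.
Proof.
move=> f1 f2 m12 A mA; apply/eqP; rewrite eq_le.
by rewrite !measure_le_ocitv// => a b /ltW ab; rewrite !measure_ocitv// !m12.
Qed.

End MeasuresOnR.

(** * Conditional bounds passed from the present to the whole past *)

Section Markov.
Context {R : realType} {d : measure_display} {T : measurableType d}.
Variable P : probability T R.
Local Open Scope ereal_scope.

Lemma gt0_integral_null (D : set T) (f : T -> R) :
  measurable D -> measurable_fun D f -> (forall x, D x -> 0 < f x)%R ->
  \int[P]_(x in D) (f x)%:E <= 0 -> P D = 0.
Proof.
move=> mD mf f0 i0.
have h : \int[P]_(x in D) `|(f x)%:E| = 0.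
  apply/eqP; rewrite eq_le integral_ge0// andbT; apply: le_trans i0.
  rewrite le_eqVlt; apply/orP; left; apply/eqP; apply: eq_integral => x.
  by rewrite inE => /f0/ltW; rewrite -lee_fin => /gee0_abs.
have mf' : measurable_fun D (fun x => (f x)%:E : \bar R) by exact/measurable_EFinP.
have [N [mN N0 sub]] := (ae_eq_integral_abs P mD mf').1 h.
apply: (subset_measure0 mD mN _ N0) => x Dx; apply: sub => /= /(_ Dx) [].
by move=> fx0; move: (f0 _ Dx); rewrite fx0 ltxx.
Qed.

Lemma measureD_null (A N : set T) :
  measurable A -> measurable N -> P N = 0 -> P (A `\` N) = P A.
Proof.
move=> mA mN N0; have mAN : measurable (A `&` N) by exact: measurableI.
rewrite -[in RHS](setUIDK A N) setUC measureU0//; first exact: measurableD.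
by apply: (subset_measure0 mAN mN _ N0); exact: subIsetr.
Qed.

Variable eta : int -> T -> R.
Hypothesis meta : is_process eta.

Lemma measurable_preimage t (B : set R) : measurable B -> measurable (eta t @^-1` B).
Proof. by move=> mB; rewrite -[X in measurable X]setTI; exact: meta. Qed.

Lemma past_measurable t E : past_sigma eta t E -> measurable E.
Proof.
move: E; apply: smallest_sub; first exact: sigma_algebra_measurable.
by move=> _ [s [B [_ [mB ->]]]]; exact: measurable_preimage.
Qed.

Lemma past_preimage s t (B : set R) : (s <= t)%R -> measurable B ->
  past_sigma eta t (eta s @^-1` B).
Proof. by move=> st mB; apply: sub_sigma_algebra; exists s, B. Qed.

Lemma past_setI t A B :
  past_sigma eta t A -> past_sigma eta t B -> past_sigma eta t (A `&` B).
Proof. exact: (@measurableI _ (g_sigma_algebraType _)). Qed.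

Lemma past_setD t A B :
  past_sigma eta t A -> past_sigma eta t B -> past_sigma eta t (A `\` B).
Proof. exact: (@measurableD _ (g_sigma_algebraType _)). Qed.

Lemma past_setT t : past_sigma eta t setT.
Proof. exact: (@measurableT _ (g_sigma_algebraType _)). Qed.

Lemma past_bigcap t (I : eqType) (s : seq I) (F : I -> set T) :
  (forall i, i \in s -> past_sigma eta t (F i)) ->
  past_sigma eta t (\big[setI/setT]_(i <- s) F i).
Proof.
move=> h; rewrite big_seq; elim/big_ind: _ => //; first exact: past_setT.
by move=> A B; exact: past_setI.
Qed.

Hypothesis markov : markov_prop P eta.

(* The function phi of markov_prop is arbitrary, but {phi < 0} and {phi > 1}
   are null, so it may be truncated to [0, 1]. *)
Lemma markov_kernel t (A : set R) : measurable A ->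
  exists phi : R -> R, [/\ measurable_fun setT phi, forall x, (0 <= phi x <= 1)%R &
    forall E, past_sigma eta t E ->
      P (eta (t + 1) @^-1` A `&` E) = \int[P]_(x in E) (phi (eta t x))%:E].
Proof.
move=> mA; have [phi [mphi h]] := markov t mA.
pose psi x := Num.min (Num.max (phi x) 0%R) 1%R.
have mpsi : measurable_fun setT psi.
  by apply: measurable_minr => //; exact: measurable_maxr.
have psi01 x : (0 <= psi x <= 1)%R.
  by rewrite /psi le_min ge_min lexx orbT ler01 le_max lexx orbT.
have mA' := measurable_preimage (t + 1) mA.
pose N1 := eta t @^-1` (phi @^-1` `]-oo, 0%R[).
pose N2 := eta t @^-1` (phi @^-1` `]1%R, +oo[).
have mph (B : set R) : measurable B -> measurable (phi @^-1` B).
  by move=> mB; rewrite -[X in measurable X]setTI; exact: mphi.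
have pN1 : past_sigma eta t N1 by apply: past_preimage => //; exact: mph.
have pN2 : past_sigma eta t N2 by apply: past_preimage => //; exact: mph.
have mN1 := past_measurable pN1; have mN2 := past_measurable pN2.
have mcomp (f : R -> R) (D : set T) : measurable_fun setT f -> measurable D ->
    measurable_fun D (f \o eta t).
  by move=> mf mD; apply: measurable_funTS; apply: measurableT_comp.
have N10 : P N1 = 0.
  apply: (@gt0_integral_null _ (fun x => - phi (eta t x))%R) => //.
  - by apply: measurableT_comp => //; exact: mcomp.
  - by move=> x; rewrite /N1/= in_itv/=; lra.
  - have e : \int[P]_(x in N1) (phi (eta t x))%:E =
        - \int[P]_(x in N1) (- phi (eta t x))%:E.
      rewrite -integral_ge0N.
        by apply: eq_integral => x _; rewrite EFinN oppeK.
      by move=> x; rewrite /N1/= in_itv/= lee_fin; lra.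
    by rewrite -oppe_ge0 -e -h// measure_ge0.
have N20 : P N2 = 0.
  apply: (@gt0_integral_null _ (fun x => phi (eta t x) - 1)%R) => //.
  - by apply: measurable_funB => //; exact: mcomp.
  - by move=> x; rewrite /N2/= in_itv/= andbT subr_gt0.
  - have e : \int[P]_(x in N2) (phi (eta t x))%:E =
        \int[P]_(x in N2) (phi (eta t x) - 1)%:E + P N2.
      rewrite -[P N2]mul1e -integral_cst// -ge0_integralD//.
      + by apply: eq_integral => x _; rewrite /= -EFinD subrK.
      + by move=> x; rewrite /N2/= in_itv/= andbT lee_fin subr_ge0 => /ltW.
      + by apply/measurable_EFinP/measurable_funB => //; exact: mcomp.
    have := h _ pN2; rewrite e => e'.
    have : P (eta (t + 1) @^-1` A `&` N2) <= P N2.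
      by apply: le_measure; rewrite ?inE//; exact: measurableI.
    rewrite e' -[leRHS]add0e leeD2rE// fin_num_measure//.
exists psi; split => // E pE.
have mE := past_measurable pE.
pose F := E `\` (N1 `|` N2).
have mN : measurable (N1 `|` N2) by exact: measurableU.
have N0 : P (N1 `|` N2) = 0 by rewrite measureU0.
have pF : past_sigma eta t F.
  by rewrite /F -setDDl; do 2 apply: past_setD => //.
have -> : P (eta (t + 1) @^-1` A `&` E) = P (eta (t + 1) @^-1` A `&` F).
  have mAE : measurable (eta (t + 1) @^-1` A `&` E) by exact: measurableI.
by rewrite -(measureD_null mAE mN N0) setIDA.
rewrite h// [RHS](ge0_negligible_integral mN)//; last 2 first.
- by apply/measurable_EFinP; exact: mcomp.
- by move=> x _; rewrite lee_fin; have /andP[] := psi01 (eta t x).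
apply: eq_integral => x; rewrite inE /F /= /N1 /N2/= !in_itv/= andbT => -[_ n].
have : ~~ (phi (eta t x) < 0)%R by apply/negP => ?; apply: n; left.
have : ~~ (1 < phi (eta t x))%R by apply/negP => ?; apply: n; right.
rewrite -!leNgt => h1 h0; congr (_%:E).
by rewrite /psi max_l// min_l.
Qed.

(** Testing the hypothesis on [{phi > M}] shows that the kernel [phi] is at most [M] almost surely
    on [{eta t \in I}]; this bound can then be integrated over any past event. *)
Lemma markov_le t (A I : set R) (M : R) : measurable A -> measurable I ->
  (0 <= M)%R ->
  (forall B, measurable B ->
    P (eta (t + 1) @^-1` A `&` eta t @^-1` (B `&` I)) <=
    M%:E * P (eta t @^-1` (B `&` I))) ->
  forall E, past_sigma eta t E ->
    P (eta (t + 1) @^-1` A `&` (E `&` eta t @^-1` I)) <=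
    M%:E * P (E `&` eta t @^-1` I).
Proof.
move=> mA mI M0 h E pE; have [phi [mphi phi01 hphi]] := markov_kernel t mA.
have mJ : measurable (phi @^-1` `]M, +oo[).
  by rewrite -[X in measurable X]setTI; exact: mphi.
pose N := eta t @^-1` (phi @^-1` `]M, +oo[ `&` I).
have pN : past_sigma eta t N by apply: past_preimage => //; exact: measurableI.
have mN := past_measurable pN.
have mcomp (D : set T) : measurable D -> measurable_fun D (phi \o eta t).
  by move=> mD; apply: measurable_funTS; apply: measurableT_comp.
have mA' := measurable_preimage (t + 1) mA.
have N0 : P N = 0.
  apply: (@gt0_integral_null _ (fun x => phi (eta t x) - M)%R) => //.
  - by apply: measurable_funB => //; exact: mcomp.
  - by move=> x [/=]; rewrite in_itv/= andbT subr_gt0.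
  - have := h _ mJ; rewrite hphi// -/N.
    have -> : \int[P]_(x in N) (phi (eta t x))%:E =
        \int[P]_(x in N) (phi (eta t x) - M)%:E + M%:E * P N.
      rewrite -integral_cst// -ge0_integralD//.
      + by apply: eq_integral => x _; rewrite /= -EFinD subrK.
      + by move=> x [/=]; rewrite in_itv/= andbT lee_fin subr_ge0 => /ltW.
      + by apply/measurable_EFinP/measurable_funB => //; exact: mcomp.
    by rewrite -[leRHS]add0e leeD2rE// fin_numM// fin_num_measure.
pose F := E `&` eta t @^-1` I.
have pF : past_sigma eta t F by apply: past_setI => //; exact: past_preimage.
have mF := past_measurable pF.
have -> : P (eta (t + 1) @^-1` A `&` F) = P (eta (t + 1) @^-1` A `&` (F `\` N)).
  have mAF : measurable (eta (t + 1) @^-1` A `&` F) by exact: measurableI.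
  by rewrite -(measureD_null mAF mN N0) setIDA.
have pFN : past_sigma eta t (F `\` N) by exact: past_setD.
have mFN := past_measurable pFN.
rewrite hphi//; apply: (@le_trans _ _ (M%:E * P (F `\` N))); last first.
  by rewrite lee_wpmul2l ?lee_fin//; apply: le_measure; rewrite ?inE//; exact: subDsetl.
rewrite -integral_cst//; apply: ge0_le_integral => //.
- by move=> x _; rewrite lee_fin; have /andP[] := phi01 (eta t x).
- by apply/measurable_EFinP; exact: mcomp.
- move=> x [[_ Ix] n]; rewrite lee_fin leNgt; apply/negP => Mx; apply: n.
  by split => //=; rewrite in_itv/= andbT.
Qed.

Lemma markov_ge t (A I : set R) (m : R) : measurable A -> measurable I ->
  (0 <= m)%R ->
  (forall B, measurable B ->
    m%:E * P (eta t @^-1` (B `&` I)) <=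
    P (eta (t + 1) @^-1` A `&` eta t @^-1` (B `&` I))) ->
  forall E, past_sigma eta t E ->
    m%:E * P (E `&` eta t @^-1` I) <=
    P (eta (t + 1) @^-1` A `&` (E `&` eta t @^-1` I)).
Proof.
move=> mA mI m0 h E pE; have [phi [mphi phi01 hphi]] := markov_kernel t mA.
have mJ : measurable (phi @^-1` `]-oo, m[).
  by rewrite -[X in measurable X]setTI; exact: mphi.
pose N := eta t @^-1` (phi @^-1` `]-oo, m[ `&` I).
have pN : past_sigma eta t N by apply: past_preimage => //; exact: measurableI.
have mN := past_measurable pN.
have mcomp (D : set T) : measurable D -> measurable_fun D (phi \o eta t).
  by move=> mD; apply: measurable_funTS; apply: measurableT_comp.
have mA' := measurable_preimage (t + 1) mA.
have N0 : P N = 0.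
  apply: (@gt0_integral_null _ (fun x => m - phi (eta t x))%R) => //.
  - by apply: measurable_funB => //; exact: mcomp.
  - by move=> x [/=]; rewrite in_itv/= subr_gt0.
  - have := h _ mJ; rewrite hphi// -/N.
    have mNfin : P (eta (t + 1) @^-1` A `&` N) \is a fin_num.
      by rewrite fin_num_measure//; exact: measurableI.
    rewrite hphi// in mNfin.
    have -> : m%:E * P N = \int[P]_(x in N) (m - phi (eta t x))%:E +
         \int[P]_(x in N) (phi (eta t x))%:E.
      rewrite -integral_cst// -ge0_integralD//.
      + by apply: eq_integral => x _; rewrite /= -EFinD subrK.
      + by move=> x [/=]; rewrite in_itv/= lee_fin subr_ge0 => /ltW.
      + by apply/measurable_EFinP/measurable_funB => //; exact: mcomp.
      + by move=> x _; rewrite lee_fin; have /andP[] := phi01 (eta t x).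
      + by apply/measurable_EFinP; exact: mcomp.
    by rewrite -[leRHS]add0e leeD2rE.
pose F := E `&` eta t @^-1` I.
have pF : past_sigma eta t F by apply: past_setI => //; exact: past_preimage.
have mF := past_measurable pF.
have pFN : past_sigma eta t (F `\` N) by exact: past_setD.
have mFN := past_measurable pFN.
have -> : P (eta (t + 1) @^-1` A `&` F) = P (eta (t + 1) @^-1` A `&` (F `\` N)).
  have mAF : measurable (eta (t + 1) @^-1` A `&` F) by exact: measurableI.
  by rewrite -(measureD_null mAF mN N0) setIDA.
have -> : P F = P (F `\` N) by rewrite (measureD_null mF mN N0).
rewrite hphi// -integral_cst//; apply: ge0_le_integral => //.
- by apply/measurable_EFinP; exact: mcomp.
- move=> x [[_ Ix] n]; rewrite lee_fin leNgt; apply/negP => Mx; apply: n.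
  by split => //=; rewrite in_itv/=.
Qed.

Let mrestr_measure E (mE : measurable E) : {measure set T -> \bar R} := mrestr P mE.

(** The law of [eta t] restricted to the event [E]. It is closed by [Defined] so that its values
    reduce to probabilities by computation. *)
Definition jointm (t : int) (E : set T) (mE : measurable E) :
  {measure set (measurableTypeR R) -> \bar R}.
Proof.
refine (pushforward (T2 := measurableTypeR R) (mrestr_measure mE) (eta t) : measure _ _).
exact: meta.
Defined.

Lemma jointmE t E (mE : measurable E) B :
  jointm t mE B = P (eta t @^-1` B `&` E).
Proof. by []. Qed.

Lemma jointm_fin t E (mE : measurable E) : jointm t mE setT < +oo.
Proof.
rewrite jointmE preimage_setT setTI; apply: (le_lt_trans (probability_le1 P mE)).
exact: ltry.
Qed.

Lemma integral_jointm t E (mE : measurable E) (phi : R -> R) :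
  measurable_fun setT phi -> (forall x, 0 <= phi x)%R ->
  \int[jointm t mE]_x (phi x)%:E = \int[P]_(x in E) (phi (eta t x))%:E.
Proof.
move=> mphi phi0.
have mf : measurable_fun setT (fun x => (phi (eta t x))%:E : \bar R).
  by apply/measurable_EFinP; apply: measurableT_comp => //; exact: meta.
rewrite ge0_integral_pushforward//; last 2 first.
- exact/measurable_EFinP.
- by move=> x _; rewrite lee_fin.
rewrite preimage_setT (_ : _ \o _ = (fun x => (phi (eta t x))%:E))//.
have nE : mrestr P mE (~` E) = 0 by rewrite /mrestr setICl measure0.
rewrite (ge0_negligible_integral (measurableC mE))//; last first.
  by move=> x _; rewrite lee_fin.
rewrite setDE setCK setTI; apply: eq_measure_integral => A mA AE.
by rewrite /= /mrestr (setIidl AE).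
exact: meta.
Qed.

(** Both sides are integrals of one and the same kernel, against laws of [eta t] that are
    proportional. An identity thus moves one step into the future although the kernel remains
    unknown. *)
Lemma markov_transfer t (E1 E2 : set T) (c : R) : (0 <= c)%R ->
  past_sigma eta t E1 -> past_sigma eta t E2 ->
  (forall B : set R, measurable B ->
    P (eta t @^-1` B `&` E1) = c%:E * P (eta t @^-1` B `&` E2)) ->
  forall A : set R, measurable A ->
    P (eta (t + 1) @^-1` A `&` E1) = c%:E * P (eta (t + 1) @^-1` A `&` E2).
Proof.
move=> c0 p1 p2 h A mA; have [phi [mphi phi01 hphi]] := markov_kernel t mA.
have m1 := past_measurable p1; have m2 := past_measurable p2.
have phi0 x : (0 <= phi x)%R by have /andP[] := phi01 x.
rewrite !hphi// -!integral_jointm//.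
rewrite -(ge0_integral_mscale _ measurableT (NngNum c0))//; last 2 first.
- exact/measurable_EFinP.
- by move=> x _; rewrite lee_fin.
by apply: eq_measure_integral => B mB _; exact: h.
Qed.

(** Measures on the line are compared through half-open intervals, on which the probabilities are
    differences of exponentials of [V]. *)
Lemma markov_le_itv t (A : set R) (M a b : R) : measurable A -> (0 <= M)%R ->
  (forall u v : R, (a <= u)%R -> (u < v)%R -> (v <= b)%R ->
    P (eta (t + 1) @^-1` A `&` eta t @^-1` `]u, v]%classic) <=
    M%:E * P (eta t @^-1` `]u, v]%classic)) ->
  forall E, past_sigma eta t E ->
    P (eta (t + 1) @^-1` A `&` (E `&` eta t @^-1` `]a, b]%classic)) <=
    M%:E * P (E `&` eta t @^-1` `]a, b]%classic).
Proof.
move=> mA M0 h; apply: markov_le => // B mB.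
have mI := measurable_preimage t (measurable_itv `]a, b]).
have mA' := measurable_preimage (t + 1) mA.
have mAI : measurable (eta (t + 1) @^-1` A `&` eta t @^-1` `]a, b]) by exact: measurableI.
rewrite preimage_setI setICA.
apply: (@measure_le_ocitv R (jointm t mAI) (mscale (NngNum M0) (jointm t mI)) _ _ _ B mB).
- exact: jointm_fin.
- by rewrite /mscale/= lte_mul_pinfty ?lee_fin//; exact: jointm_fin.
- move=> u v uv; rewrite jointmE -[leRHS]/(M%:E * P _).
  rewrite setICA -preimage_setI.
  have -> : `]u, v]%classic `&` `]a, b]%classic =
      `]Num.max u a, Num.min v b]%classic.
    apply/seteqP; split => x/=; rewrite !in_itv/= gt_max le_min.
      by move=> [/andP[-> ->] /andP[-> ->]].
    by move=> /andP[/andP[-> ->] /andP[-> ->]].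
  have [uv'|vu] := ltP (Num.max u a) (Num.min v b).
    by apply: h => //; rewrite ?le_max ?ge_min lexx orbT.
  by rewrite set_itv_ge ?bnd_simp -?leNgt// preimage_set0 setI0 measure0 mule0.
Qed.

Lemma markov_ge_itv t (A : set R) (m a b : R) : measurable A -> (0 <= m)%R ->
  (forall u v : R, (a <= u)%R -> (u < v)%R -> (v <= b)%R ->
    m%:E * P (eta t @^-1` `]u, v]%classic) <=
    P (eta (t + 1) @^-1` A `&` eta t @^-1` `]u, v]%classic)) ->
  forall E, past_sigma eta t E ->
    m%:E * P (E `&` eta t @^-1` `]a, b]%classic) <=
    P (eta (t + 1) @^-1` A `&` (E `&` eta t @^-1` `]a, b]%classic)).
Proof.
move=> mA M0 h; apply: markov_ge => // B mB.
have mI := measurable_preimage t (measurable_itv `]a, b]).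
have mA' := measurable_preimage (t + 1) mA.
have mAI : measurable (eta (t + 1) @^-1` A `&` eta t @^-1` `]a, b]) by exact: measurableI.
rewrite preimage_setI setICA.
apply: (@measure_le_ocitv R (mscale (NngNum M0) (jointm t mI)) (jointm t mAI) _ _ _ B mB).
- by rewrite /mscale/= lte_mul_pinfty ?lee_fin//; exact: jointm_fin.
- exact: jointm_fin.
- move=> u v uv; rewrite jointmE -[leLHS]/(m%:E * P _).
  rewrite setICA -preimage_setI.
  have -> : `]u, v]%classic `&` `]a, b]%classic =
      `]Num.max u a, Num.min v b]%classic.
    apply/seteqP; split => x/=; rewrite !in_itv/= gt_max le_min.
      by move=> [/andP[-> ->] /andP[-> ->]].
    by move=> /andP[/andP[-> ->] /andP[-> ->]].
  have [uv'|vu] := ltP (Num.max u a) (Num.min v b).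
    by apply: h => //; rewrite ?le_max ?ge_min lexx orbT.
  by rewrite set_itv_ge ?bnd_simp -?leNgt// preimage_set0 setI0 measure0 mule0.
Qed.

End Markov.

(** * Max-stability and the exponent function *)

Section Copies.
Context {R : realType}.
Local Open Scope ereal_scope.

Lemma cyl_measurable {d} {T : measurableType d} (xi : int -> T -> R) ts Bs :
  is_process xi -> (forall i, measurable (Bs i)) -> measurable (cyl xi ts Bs).
Proof.
by move=> mxi mB; apply: bigcap_measurableType => i _; exact: measurable_preimage.
Qed.

(* simple_max_stable quantifies over independent copies, which have to be
   constructed; product spaces provide them. *)
Lemma independent_copies {d} {T : measurableType d} (P : probability T R)
    (eta : int -> T -> R) (n : nat) : is_process eta ->
  exists (d' : measure_display) (T' : measurableType d') (P' : probability T' R)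
    (xi : nat -> int -> T' -> R),
    [/\ forall i, is_process (xi i), indep_processes P' n xi &
      forall i, (i < n)%N -> eqd P' (xi i) P eta].
Proof.
move=> meta; elim: n => [|n [d' [T' [P' [xi [mxi ixi exi]]]]]].
  exists d, T, P, (fun _ => eta); split => // ts Bs mB.
  by rewrite big_ord0 II0 bigcap_set0 probability_setT.
pose xi' (i : nat) (t : int) (w : T * T') :=
  if i is i'.+1 then xi i' t w.2 else eta t w.1.
have c0 ts Bs : cyl (xi' 0%N) ts Bs = cyl eta ts Bs `*` setT.
  by apply/seteqP; split => -[w w'] /=; [move=> h; split|move=> [h _]] => // i /h.
have cS i ts Bs : cyl (xi' i.+1) ts Bs = setT `*` cyl (xi i) ts Bs.
  by apply/seteqP; split => -[w w'] /=; [move=> h; split|move=> [_ h]] => // j /h.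
pose Q : probability (T * T')%type R := (P \x P').
have QE A B : measurable A -> measurable B -> Q (A `*` B) = P A * P' B.
  by move=> mA mB; exact: product_measure1E.
exists _, (T * T')%type, Q, xi'; split.
- case=> [|i] t /=; first by apply: measurableT_comp => //; exact: meta.
  by apply: measurableT_comp => //; exact: mxi.
- move=> ts Bs mB.
  have -> : \bigcap_(i in `I_n.+1) cyl (xi' i) ts (Bs i) =
      cyl eta ts (Bs 0%N) `*` \bigcap_(i in `I_n) cyl (xi i) ts (Bs i.+1).
    apply/seteqP; split => [[w w'] h|[w w'] [/= h0 h] [|i] /= hi].
    + split; first by have := h 0%N isT; rewrite c0 => -[].
      by move=> i hi /=; have := h i.+1 hi; rewrite cS => -[].
    + by rewrite c0.
    + by rewrite cS; split => //; exact: h.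
  rewrite QE//; last 2 first.
    exact: cyl_measurable.
    by apply: bigcap_measurableType => i _; exact: cyl_measurable.
  rewrite big_ord_recl ixi// c0 QE//; last exact: cyl_measurable.
  rewrite probability_setT mule1; congr (_ * _); apply: eq_bigr => i _.
  rewrite -[lift ord0 i : nat]/(i.+1) cS QE//; last exact: cyl_measurable.
  by rewrite probability_setT mul1e.
- case=> [|i] hi ts Bs mB.
    rewrite c0 QE//; last exact: cyl_measurable.
    by rewrite probability_setT mule1.
  rewrite cS QE//; last exact: cyl_measurable.
  by rewrite probability_setT mul1e; exact: exi.
Qed.

(** The rescaled maximum of [n] copies is at most [y] exactly when each copy is at most [n y];
    independence then factorises the event. *)
Lemma max_stable_cyl {d} {T : measurableType d} (P : probability T R)
    (eta : int -> T -> R) (ts : seq int) (y : nat -> R) (n : nat) :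
  is_process eta -> simple_max_stable P eta -> (0 < n)%N ->
  P (cyl eta ts (fun i => `]-oo, y i]%classic)) =
  \prod_(i < n) P (cyl eta ts (fun i => `]-oo, (n%:R * y i)%R]%classic)).
Proof.
move=> meta [_ ms] n0; have [d' [T' [P' [xi [mxi ixi exi]]]]] := independent_copies P n meta.
have mB (z : nat -> R) i : measurable (`]-oo, z i]%classic : set R) by [].
rewrite -(ms n n0 _ _ _ _ mxi ixi exi ts _ (mB y)).
transitivity (P' (\bigcap_(i in `I_n) cyl (xi i) ts
    (fun i => `]-oo, (n%:R * y i)%R]%classic))).
  congr (P' _); apply/seteqP; split => w h.
    move=> i hi j hj; have /= := h j hj; rewrite !in_itv/= => hm.
    rewrite mulrC -ler_pdivrMr ?ltr0n// mulrC; apply: le_trans hm.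
    rewrite ler_pM2l ?invr_gt0 ?ltr0n//.
    exact: (le_bigmax _ (fun i : 'I_n => xi i (nth 0%R ts j) w) (Ordinal hi)).
  move=> j hj /=; rewrite in_itv/= mulrC ler_pdivrMr ?ltr0n// mulrC.
  have le_xi k : (k < n)%N -> (xi k (nth 0%R ts j) w <= n%:R * y j)%R.
    by move=> hk; have := h k hk j hj; rewrite /= in_itv/=.
  by apply: bigmax_le => [|i _]; exact: le_xi.
rewrite (ixi ts (fun _ => fun i => `]-oo, (n%:R * y i)%R]%classic))//.
by apply: eq_bigr => i _; apply: exi.
Qed.

End Copies.

(** * Homogeneity from integer scaling, and exponents compared through exponentials *)

Section Homogeneity.
Context {R : realType}.

(** Trapping [n l] between consecutive integers bounds [n |l v(l) - v(1)|] by [v l], uniformly in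
    [n]. *)
Lemma homogeneous_of_nat (v : R -> R) :
  (forall l, 0 < l -> 0 <= v l) ->
  (forall l m, 0 < l -> l <= m -> v m <= v l) ->
  (forall (n : nat) l, (0 < n)%N -> 0 < l -> v (n%:R * l) = v l / n%:R) ->
  forall l, 0 < l -> v l = v 1 / l.
Proof.
move=> v0 vm vn l l0.
have key (n : nat) : (0 < n)%N -> `|n%:R * (l * v l - v 1)| <= v l.
  move=> n0; have np : 0 < n%:R :> R by rewrite ltr0n.
  have nl : 0 < n%:R * l by rewrite mulr_gt0.
  have := truncn_itv (ltW nl); set m := Num.truncn _ => /andP[m1 m2].
  have e := vn n l n0 l0; have vl := v0 _ l0.
  have h1 : n%:R * v 1 <= m.+1%:R * v l.
    have := vm _ _ nl (ltW m2); rewrite e -[m.+1%:R]mulr1 vn// mulr1.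
    by rewrite ler_pdivrMr ?ltr0n// mulrAC ler_pdivlMr// mulrC [v l * _]mulrC.
  have h2 : m%:R * v l <= n%:R * v 1.
    (* When [m = 0] the monotonicity of [v] cannot be invoked, since nothing is known of [v] at
       0. *)
    have [->|mpos] := posnP m; first by rewrite mul0r mulr_ge0 ?ler0n ?v0.
    have := vm m%:R (n%:R * l); rewrite ltr0n => /(_ mpos m1).
    rewrite e -[m%:R]mulr1 vn// mulr1.
    by rewrite ler_pdivrMr ?ltr0n// mulrAC ler_pdivlMr ?ltr0n// mulrC [v 1 * _]mulrC.
  have h3 : m.+1%:R * v l <= (n%:R * l + 1) * v l.
    by rewrite ler_wpM2r// -natr1 lerD2r.
  have h4 : (n%:R * l - 1) * v l <= m%:R * v l.
    by rewrite ler_wpM2r// lerBlDr natr1 ltW.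
  rewrite ler_norml; apply/andP; split; move: h1 h2 h3 h4;
    rewrite ?mulrDl ?mulrBl ?mulrBr ?mul1r mulrA; lra.
have -> : v 1 = l * v l; last by rewrite mulrAC divff ?mul1r// gt_eqF.
apply/eqP; rewrite eq_sym -subr_eq0 -normr_le0; apply/ler_addgt0Pr => e e0; rewrite add0r.
pose n := (Num.truncn (v l / e)).+1.
have := key n isT; rewrite normrM ger0_norm ?ler0n//.
rewrite mulrC -ler_pdivlMr ?ltr0n// => h; apply: (le_trans h).
rewrite ler_pdivrMr ?ltr0n// mulrC -ler_pdivrMr//; exact/ltW/truncnS_gt.
Qed.

Lemma le_of_exp_damped (b c B : R) : 0 <= c ->
  (forall l, 0 < l -> b * expR (- l * c) <= B) -> b <= B.
Proof.
move=> c0 h; have [b0|b0] := leP b 0.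
  apply: le_trans (h 1 ltr01); rewrite -[leLHS]mulr1 ler_wnM2l//.
  by rewrite -[leRHS]expR0 ler_expR; lra.
apply/ler_addgt0Pr => e e0.
pose l := e / (b * (c + 1)).
have p0 : 0 < b * (c + 1) by rewrite mulr_gt0//; lra.
have l0 : 0 < l by rewrite divr_gt0.
have h1 := h l l0; have h2 := expR_ge1Dx (- l * c).
have h3 : b * (1 + - l * c) <= B by apply: le_trans h1; rewrite ler_pM2l.
have h4 : b * (l * c) <= e.
  have -> : b * (l * c) = e * (b * c / (b * (c + 1))) by rewrite /l; ring.
  rewrite ger_pMr// ler_pdivrMr// mul1r ler_pM2l//; lra.
by move: h3 h4; rewrite mulNr mulrBr mulr1; lra.
Qed.

(** To first order in [l -> 0], each difference of exponentials is [l] times a difference of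
    exponents. Inclusions of events valid at every scale thereby become inequalities between
    increments of [V]. *)
Lemma le_sub_of_exp (a1 b1 a2 b2 : R) : 0 <= b1 -> 0 <= a2 -> a2 <= b2 ->
  (forall l, 0 < l -> expR (- l * a1) - expR (- l * b1) <=
     expR (- l * a2) - expR (- l * b2)) ->
  b1 - a1 <= b2 - a2.
Proof.
move=> b10 a20 ab h; apply: (le_of_exp_damped b10) => l l0.
rewrite -(ler_pM2l l0) mulrA; apply: le_trans (expRN_sub_ge _ _ _) _.
apply: le_trans (h _ l0) _; apply: le_trans (expRN_sub_le _ _ _) _.
apply: ler_piMr; first by rewrite mulr_ge0 ?subr_ge0// ltW.
by rewrite -[leRHS]expR0 ler_expR mulNr oppr_le0 mulr_ge0// ltW.
Qed.

End Homogeneity.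

Section KernelBounds.
Context {R : realType}.

(** In the application the left side is the joint probability of the future event and of the present
    lying in a small interval, and the difference on the right is the probability of that interval.
    Their ratio is an average of [f' e^{l (u - f u)}], with [f' <= 1], [u <= w] and [f u >= f v]. *)
Lemma kernel_upper (f : R -> R) (l v w v' w' : R) :
  0 < l -> v' <= w' -> w' <= w -> f v <= f v' -> f w' - f v' <= w' - v' ->
  expR (- l * f v') - expR (- l * f w') <=
  expR (l * (w - f v)) * (expR (- l * v') - expR (- l * w')).
Proof.
move=> l0 vw' ww' fv lip; apply: le_trans (expRN_sub_le _ _ _) _.
apply: le_trans (ler_wpM2l (expR_ge0 _) (expRN_sub_ge l v' w')).
rewrite mulrCA -expRD; apply: (@le_trans _ _ (l * (w' - v') * expR (- l * f v'))).
  by rewrite ler_wpM2r ?expR_ge0// ler_pM2l.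
apply: ler_wpM2l; first by rewrite mulr_ge0 ?subr_ge0// ltW.
rewrite ler_expR -subr_ge0.
have -> : l * (w - f v) + - l * w' - - l * f v' = l * (w - w' + (f v' - f v)) by ring.
by apply: mulr_ge0; [exact: ltW | rewrite addr_ge0 ?subr_ge0].
Qed.

Lemma kernel_lower (f : R -> R) (k l v w v' w' : R) :
  0 < l -> 0 <= k -> v <= v' -> v' <= w' -> f w' <= f w ->
  k * (w' - v') <= f w' - f v' ->
  k * expR (l * (v - f w)) * (expR (- l * v') - expR (- l * w')) <=
  expR (- l * f v') - expR (- l * f w').
Proof.
move=> l0 k0 vv' vw' fw low; apply: le_trans (expRN_sub_ge _ _ _).
have p : 0 <= k * expR (l * (v - f w)) by rewrite mulr_ge0 ?expR_ge0.
apply: le_trans (ler_wpM2l p (expRN_sub_le l v' w')) _.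
have -> : k * expR (l * (v - f w)) * (l * (w' - v') * expR (- l * v')) =
  l * (k * (w' - v')) * expR (l * (v - f w) + - l * v') by rewrite expRD; ring.
apply: (@le_trans _ _ (l * (k * (w' - v')) * expR (- l * f w'))).
  apply: ler_wpM2l; first by rewrite mulr_ge0 ?mulr_ge0 ?subr_ge0// ltW.
  rewrite ler_expR -subr_ge0.
  have -> : - l * f w' - (l * (v - f w) + - l * v') = l * (f w - f w' + (v' - v)) by ring.
  by apply: mulr_ge0; [exact: ltW | rewrite addr_ge0 ?subr_ge0].
by rewrite ler_wpM2r ?expR_ge0// ler_pM2l.
Qed.

End KernelBounds.

Section RealProbability.
Context {R : realType} {d : measure_display} {T : measurableType d}.
Variable P : probability T R.

Definition pr (A : set T) : R := fine (P A).

Lemma prE A : measurable A -> P A = (pr A)%:E.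
Proof. by move=> mA; rewrite fineK// fin_num_measure. Qed.

Lemma pr_le A B : measurable A -> measurable B -> A `<=` B -> pr A <= pr B.
Proof. by move=> mA mB AB; rewrite -lee_fin -!prE// le_measure ?inE. Qed.

Lemma pr_le1 A : measurable A -> pr A <= 1.
Proof. by move=> mA; rewrite -lee_fin -prE// probability_le1. Qed.

Lemma prU_le A B : measurable A -> measurable B -> pr (A `|` B) <= pr A + pr B.
Proof.
move=> mA mB; rewrite -lee_fin EFinD -!prE//; last exact: measurableU.
exact: measureU2.
Qed.

Lemma prC A : measurable A -> pr (~` A) = 1 - pr A.
Proof.
move=> mA; apply: EFin_inj; rewrite -prE; last exact: measurableC.
by rewrite probability_setC// prE.
Qed.

Lemma prI_ge A B C : measurable A -> measurable B -> measurable C ->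
  pr A + pr B + pr C - 2 <= pr (A `&` (B `&` C)).
Proof.
move=> mA mB mC.
have mBC : measurable (B `&` C) by exact: measurableI.
have mABC : measurable (A `&` (B `&` C)) by exact: measurableI.
have := prC mABC; rewrite !setCI => e.
have h1 := prU_le (measurableC mA) (measurableU _ _ (measurableC mB) (measurableC mC)).
have h2 := prU_le (measurableC mB) (measurableC mC).
by move: h1 h2; rewrite e !prC//; lra.
Qed.

End RealProbability.

(** * The exponent function [V]: homogeneity, scale convexity and bounds *)

Section ExponentFunction.
Context {R : realType} {d : measure_display} {T : measurableType d}.
Variables (P : probability T R) (eta : int -> T -> R).
Hypotheses (meta : is_process eta) (ms : simple_max_stable P eta).

Definition sublevel t (y : R) : set T := eta t @^-1` `]-oo, y].

Lemma sublevel_measurable t y : measurable (sublevel t y).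
Proof. exact: measurable_preimage. Qed.
Local Hint Resolve sublevel_measurable : core.

Lemma sublevel_mono t y z : y <= z -> sublevel t y `<=` sublevel t z.
Proof. by move=> yz w; rewrite /sublevel/= !in_itv/= => /le_trans; apply. Qed.

Lemma pr_sublevel t y : 0 < y -> pr P (sublevel t y) = expR (- y^-1).
Proof. by move=> y0; rewrite /pr /sublevel (proj1 ms). Qed.

Lemma pr_sublevel_sub (E : set T) t (a b : R) : measurable E -> a <= b ->
  pr P (E `&` sublevel t b) - pr P (E `&` sublevel t a) = pr P (E `&` eta t @^-1` `]a, b]).
Proof.
move=> mE ab.
have mI : measurable (eta t @^-1` `]a, b]) by exact: measurable_preimage.
have mEI : measurable (E `&` eta t @^-1` `]a, b]) by exact: measurableI.
have mEa : measurable (E `&` sublevel t a) by exact: measurableI.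
have mEb : measurable (E `&` sublevel t b) by exact: measurableI.
have e : P (E `&` sublevel t b) = (P (E `&` sublevel t a) + P (E `&` eta t @^-1` `]a, b]))%E.
  rewrite -measureU//.
    rewrite -setIUr; congr (P (_ `&` _)); apply/seteqP; split => w; rewrite /sublevel /= !in_itv/=.
      by move=> wb; have [wa|wa] := leP (eta t w) a; [left|right].
    by case=> [wa|/andP[]//]; exact: le_trans wa ab.
  apply/seteqP; split => w //=; rewrite /sublevel/= !in_itv/= => -[[_ wa] [_ /andP[aw _]]].
  by move: (lt_le_trans aw wa); rewrite ltxx.
rewrite !prE// -EFinD in e; case: e => ->; ring.
Qed.

Definition G s t u (x y z : R) : R := pr P (sublevel s x `&` (sublevel t y `&` sublevel u z)).

Lemma G_measurable s t u x y z : measurable (sublevel s x `&` (sublevel t y `&` sublevel u z)).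
Proof. by apply: measurableI => //; exact: measurableI. Qed.
Local Hint Resolve G_measurable : core.

Lemma G_pow s t u x y z n : (0 < n)%N ->
  G s t u x y z = G s t u (n%:R * x) (n%:R * y) (n%:R * z) ^+ n.
Proof.
move=> n0.
have cyl3 (B : nat -> set R) : cyl eta [:: s; t; u] B =
    eta s @^-1` B 0%N `&` (eta t @^-1` B 1%N `&` eta u @^-1` B 2%N).
  apply/seteqP; split => w.
    by move=> h; split; [exact: (h 0%N)|split; [exact: (h 1%N)|exact: (h 2%N)]].
  by move=> [h0 [h1 h2]] [|[|[|i]]].
have := @max_stable_cyl R d T P eta [:: s; t; u] (fun i => nth 0 [:: x; y; z] i) n meta ms n0.
rewrite !cyl3/= => e; apply: EFin_inj.
have key (g : R) m : (\prod_(i < m) g%:E)%E = (g ^+ m)%:E.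
  by elim: m => [|m IH]; rewrite ?big_ord0// big_ord_recl IH exprS EFinM.
rewrite -prE; last exact: G_measurable.
rewrite e prE; last exact: G_measurable.
exact: key.
Qed.

Lemma G_mono s t u x y z x' y' z' : x <= x' -> y <= y' -> z <= z' ->
  G s t u x y z <= G s t u x' y' z'.
Proof.
move=> xx yy zz; apply: pr_le => //.
by apply: setISS; [|apply: setISS]; exact: sublevel_mono.
Qed.

Lemma G_lower s t u x y z : 0 < x -> 0 < y -> 0 < z ->
  1 - x^-1 - y^-1 - z^-1 <= G s t u x y z.
Proof.
move=> x0 y0 z0; apply: le_trans (prI_ge _ _ _ _) => //.
rewrite !pr_sublevel//.
have := expR_ge1Dx (- x^-1); have := expR_ge1Dx (- y^-1).
have := expR_ge1Dx (- z^-1); lra.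
Qed.

(** The union bound is positive only at high levels; max-stability with [n > 1/x + 1/y + 1/z] moves
    the levels there at the price of an [n]-th power. This is what makes the logarithm in [V]
    meaningful. *)
Lemma G_gt0 s t u x y z : 0 < x -> 0 < y -> 0 < z -> 0 < G s t u x y z.
Proof.
move=> x0 y0 z0; set c := x^-1 + y^-1 + z^-1.
have c0 : 0 < c by rewrite !addr_gt0 ?invr_gt0.
pose n := (Num.truncn c).+1.
have np : 0 < n%:R :> R by rewrite ltr0n.
rewrite (@G_pow _ _ _ _ _ _ n)// exprn_gt0//.
apply: lt_le_trans (G_lower _ _ _ _ _ _); rewrite ?mulr_gt0// !invfM.
have : c / n%:R < 1 by rewrite ltr_pdivrMr// mul1r truncnS_gt.
by rewrite /c mulrDl mulrDl ![_ / n%:R]mulrC; lra.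
Qed.

Definition V s t u (x y z : R) : R := - ln (G s t u x y z).

Lemma expR_V s t u x y z : 0 < x -> 0 < y -> 0 < z ->
  expR (- V s t u x y z) = G s t u x y z.
Proof. by move=> x0 y0 z0; rewrite opprK lnK// posrE G_gt0. Qed.

Lemma V_ge0 s t u x y z : 0 < x -> 0 < y -> 0 < z -> 0 <= V s t u x y z.
Proof. by move=> x0 y0 z0; rewrite oppr_ge0 ln_le0// pr_le1. Qed.

Lemma V_mono s t u x y z x' y' z' : 0 < x -> 0 < y -> 0 < z ->
  x <= x' -> y <= y' -> z <= z' -> V s t u x' y' z' <= V s t u x y z.
Proof.
move=> x0 y0 z0 xx yy zz; rewrite lerN2 ler_ln ?posrE ?G_gt0 ?G_mono//.
- exact: lt_le_trans xx.
- exact: lt_le_trans yy.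
- exact: lt_le_trans zz.
Qed.

Lemma V_hom s t u x y z l : 0 < x -> 0 < y -> 0 < z -> 0 < l ->
  V s t u (l * x) (l * y) (l * z) = V s t u x y z / l.
Proof.
move=> x0 y0 z0 l0.
rewrite (@homogeneous_of_nat _ (fun l => V s t u (l * x) (l * y) (l * z)))//.
- by rewrite !mul1r.
- by move=> m m0; rewrite V_ge0// mulr_gt0.
- by move=> m n m0 mn; apply: V_mono; rewrite ?mulr_gt0// ler_pM2r.
- move=> n m n0 m0; rewrite /V [in RHS](@G_pow _ _ _ _ _ _ n)//.
  have dn (a : R) : - (a *+ n) / n%:R = - a.
    by rewrite -[a *+ n]mulr_natr mulNr mulfK// pnatr_eq0 -lt0n.
  by rewrite lnXn ?G_gt0 ?mulr_gt0 ?ltr0n// dn !mulrA.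
Qed.

(** This is the source of the free parameter [l]: multiplying the exponent by [l] amounts to
    dividing all levels by [l]. *)
Lemma expR_lV s t u x y z l : 0 < x -> 0 < y -> 0 < z -> 0 < l ->
  expR (- l * V s t u x y z) = G s t u (x / l) (y / l) (z / l).
Proof.
move=> x0 y0 z0 l0; rewrite -expR_V ?divr_gt0// ![_ / l]mulrC V_hom ?invr_gt0//.
by rewrite invrK mulNr mulrC.
Qed.

Lemma expR_marginal t y l : 0 < y -> 0 < l -> expR (- l * y) = pr P (sublevel t (y^-1 / l)).
Proof.
move=> y0 l0; rewrite pr_sublevel ?divr_gt0 ?invr_gt0//.
by rewrite invfM !invrK mulNr mulrC.
Qed.

Lemma V_diff s t u x z (a b l : R) : 0 < x -> 0 < z -> 0 < a -> a <= b -> 0 < l ->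
  expR (- l * V s t u x a^-1 z) - expR (- l * V s t u x b^-1 z) =
  pr P ((sublevel s (x / l) `&` sublevel u (z / l)) `&` eta t @^-1` `]b^-1 / l, a^-1 / l]).
Proof.
move=> x0 z0 a0 ab l0; have b0 : 0 < b by exact: lt_le_trans ab.
rewrite !expR_lV ?invr_gt0// -pr_sublevel_sub//; last 2 first.
- exact: measurableI.
- by rewrite ler_pM2r ?invr_gt0// lef_pV2.
by rewrite /G; congr (pr P _ - pr P _); rewrite -setIA [sublevel t _ `&` _]setIC.
Qed.

Lemma marginal_diff t (a b l : R) : 0 < a -> a <= b -> 0 < l ->
  expR (- l * a) - expR (- l * b) = pr P (eta t @^-1` `]b^-1 / l, a^-1 / l]).
Proof.
move=> a0 ab l0; have b0 : 0 < b by exact: lt_le_trans ab.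
rewrite (expR_marginal t a0 l0) (expR_marginal t b0 l0).
rewrite -(setTI (sublevel t (a^-1 / l))) -(setTI (sublevel t (b^-1 / l))) pr_sublevel_sub ?setTI//.
by rewrite ler_pM2r ?invr_gt0// lef_pV2.
Qed.

(** The last two properties are inclusions of events, read to first order in [l]. Forgetting the
    outer events gives the Lipschitz bound. For the scaling bound, both sides involve the same
    interval for [eta t], but the outer levels are [r] times lower on the left. *)
Lemma V_scale_convex s t u x z : 0 < x -> 0 < z ->
  scale_convex (fun v => V s t u x v^-1 z).
Proof.
move=> x0 z0.
have step a b l := @V_diff s t u x z a b l x0 z0.
have mE (c e : R) : measurable (sublevel s c `&` sublevel u e) by exact: measurableI.
have mI (c e : R) : measurable (eta t @^-1` `]c, e]) by exact: measurable_preimage.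
have mEI c e c' e' : measurable (sublevel s c `&` sublevel u e `&` eta t @^-1` `]c', e']) by exact: measurableI.
have mono (a b : R) : 0 < a -> a <= b -> V s t u x a^-1 z <= V s t u x b^-1 z.
  move=> a0 ab; have b0 : 0 < b by exact: lt_le_trans ab.
  by apply: V_mono; rewrite ?invr_gt0 ?lef_pV2.
split => //.
- move=> a b a0 ab; have b0 : 0 < b by exact: lt_le_trans ab.
  apply: le_sub_of_exp => [|||l l0].
  - by rewrite V_ge0 ?invr_gt0.
  - exact: ltW.
  - by [].
  rewrite step// (marginal_diff t a0 ab l0).
  by apply: pr_le => //; exact: subIsetr.
- move=> r a b r1 a0 ab; have b0 : 0 < b by exact: lt_le_trans ab.
  have r0 : 0 < r by exact: lt_le_trans r1.
  rewrite mulrBr; apply: le_sub_of_exp => [|||l l0].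
  - by apply: mulr_ge0; [exact: ltW | rewrite V_ge0 ?invr_gt0].
  - by rewrite V_ge0 ?invr_gt0 ?mulr_gt0.
  - by apply: mono; rewrite ?mulr_gt0 ?ler_pM2l.
  rewrite ![- l * (r * _)]mulrA ![- l * r]mulNr !step ?mulr_gt0 ?ler_pM2l//.
  have -> : b^-1 / (l * r) = (r * b)^-1 / l by rewrite !invfM; ring.
  have -> : a^-1 / (l * r) = (r * a)^-1 / l by rewrite !invfM; ring.
  apply: pr_le => //; apply: setSI; apply: setISS; apply: sublevel_mono.
    by rewrite ler_pM2l// lef_pV2 ?posrE ?mulr_gt0// ler_peMr// ltW.
  by rewrite ler_pM2l// lef_pV2 ?posrE ?mulr_gt0// ler_peMr// ltW.
Qed.

(** The two extremes are complete dependence and independence. The lower bound comes from the single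
    marginals, the upper one from the union bound as [l -> 0]. *)
Lemma V_bounds s t v : 0 < v -> Num.max v 1 <= V s t s 1 v^-1 1 <= v + 1.
Proof.
move=> v0; have v0' : 0 < v^-1 by rewrite invr_gt0.
have sub A : measurable A -> (sublevel s 1 `&` (sublevel t v^-1 `&` sublevel s 1) `<=` A) ->
    G s t s 1 v^-1 1 <= pr P A by move=> mA; exact: pr_le.
have e := expR_V s t s ltr01 v0' ltr01.
apply/andP; split.
  rewrite ge_max; apply/andP; split.
    have := sub _ (sublevel_measurable t v^-1); rewrite -e pr_sublevel// invrK ler_expR lerN2.
    by apply => w [_ []].
  have := sub _ (sublevel_measurable s 1); rewrite -e pr_sublevel// invr1 ler_expR lerN2.
  by apply => w [].
apply: (@le_of_exp_damped _ _ (V s t s 1 v^-1 1)); first exact: V_ge0.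
move=> l l0; rewrite -(ler_pM2l l0) mulrA.
have := expRN_sub_ge l 0 (V s t s 1 v^-1 1); rewrite subr0 => /le_trans; apply.
rewrite mulr0 expR0 expR_lV// div1r.
have -> : G s t s l^-1 (v^-1 / l) l^-1 = pr P (setT `&` (sublevel t (v^-1 / l) `&` sublevel s l^-1)).
  by rewrite /G setTI; congr (pr P _); rewrite [sublevel t _ `&` _]setIC setIA setIid.
have := prI_ge P measurableT (sublevel_measurable t (v^-1 / l)) (sublevel_measurable s l^-1).
have -> : pr P setT = 1 by rewrite /pr probability_setT.
rewrite !pr_sublevel ?divr_gt0 ?invr_gt0// invfM !invrK.
have := expR_ge1Dx (- (v * l)); have := expR_ge1Dx (- l); lra.
Qed.

End ExponentFunction.

(** * Bivariate laws *)

Section BivariateLaw.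
Context {R : realType} {d : measure_display} {T : measurableType d}.
Variables (P : probability T R) (eta : int -> T -> R).
Hypotheses (meta : is_process eta) (ms : simple_max_stable P eta).
Hypothesis markov : markov_prop P eta.
Variable t : int.

Local Notation V := (V P eta).

Let past_sublevel s y : s <= t -> past_sigma eta t (sublevel eta s y).
Proof. by move=> st; exact: past_preimage. Qed.

Let le_past : t - 1 <= t.
Proof. by rewrite lerBlDr lerDl. Qed.

Let msub s y : measurable (sublevel eta s y). Proof. exact: sublevel_measurable. Qed.

Let mitv s (a b : R) : measurable (eta s @^-1` `]a, b]).
Proof. exact: measurable_preimage. Qed.

Lemma invr_mul_divK (u l : R) : 0 < u -> 0 < l -> ((u * l)^-1)^-1 / l = u.
Proof. by move=> u0 l0; rewrite invrK mulfK// gt_eqF. Qed.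

(** The factor on the right depends only on the law of present and future; the past event
    [{eta (t - 1) <= X / l}] enters through the Markov property alone. *)
Lemma markov_upper (X Z l v w : R) : 0 < X -> 0 < Z -> 0 < l -> 0 < v -> v < w ->
  expR (- l * V (t - 1) t (t + 1) X v^-1 Z) - expR (- l * V (t - 1) t (t + 1) X w^-1 Z) <=
  expR (l * (w - V (t + 1) t (t + 1) Z v^-1 Z)) *
  (expR (- l * V (t - 1) t (t - 1) X v^-1 X) - expR (- l * V (t - 1) t (t - 1) X w^-1 X)).
Proof.
move=> X0 Z0 l0 v0 vw; have w0 := lt_trans v0 vw.
rewrite !V_diff// ?(ltW vw)// setIid; set M := expR _.
set I := eta t @^-1` _.
have mEI : measurable (sublevel eta (t - 1) (X / l) `&` I).
  by apply: measurableI; [exact: msub | exact: mitv].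
have mEAI : measurable (sublevel eta (t + 1) (Z / l) `&` (sublevel eta (t - 1) (X / l) `&` I)).
  by apply: measurableI; first exact: msub.
rewrite -setIA setICA -lee_fin EFinM -!prE//.
apply: (markov_le_itv meta markov) => //; [exact: expR_ge0| |exact: past_sublevel].
move=> u u' au uu' u'b.
have u0 : 0 < u by apply: lt_le_trans au; rewrite divr_gt0 ?invr_gt0.
have u'0 := lt_trans u0 uu'.
rewrite !prE//; last by apply: measurableI; [exact: msub | exact: mitv].
rewrite -EFinM lee_fin -/(sublevel _ _ _) -[sublevel _ _ _](setIid).
(* A level [u] of [eta t] corresponds to the argument [1 / (u l)] of the exponent; in this form
   [V_diff] and [marginal_diff] apply. *)
rewrite -[in `]u, _]](invr_mul_divK u0 l0) -[in `]_, u']](invr_mul_divK u'0 l0).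
have p0 : 0 < u * l by rewrite mulr_gt0.
have p0' : 0 < u' * l by rewrite mulr_gt0.
have uu'' : (u' * l)^-1 <= (u * l)^-1 by rewrite lef_pV2 ?posrE// ler_pM2r// ltW.
rewrite -V_diff ?invr_gt0// -marginal_diff ?invr_gt0//.
have vu' : v <= (u' * l)^-1.
  by rewrite -[v]invrK lef_pV2 ?posrE ?invr_gt0// -ler_pdivlMr.
have [Vm Vl _] := V_scale_convex meta ms (t + 1) t (t + 1) Z0 Z0.
apply: (kernel_upper (f := fun x => V (t + 1) t (t + 1) Z x^-1 Z)) => //.
- by rewrite -[w]invrK lef_pV2 ?posrE ?invr_gt0// -ler_pdivrMr.
- exact: Vm.
- by apply: Vl; rewrite ?invr_gt0.
Qed.

Lemma markov_lower (X Z k l v w : R) : 0 < X -> 0 < Z -> 0 <= k -> 0 < l ->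
  0 < v -> v < w ->
  (forall x y, v <= x -> x <= y ->
    k * (y - x) <= V (t + 1) t (t + 1) Z y^-1 Z - V (t + 1) t (t + 1) Z x^-1 Z) ->
  k * expR (l * (v - V (t + 1) t (t + 1) Z w^-1 Z)) *
  (expR (- l * V (t - 1) t (t - 1) X v^-1 X) - expR (- l * V (t - 1) t (t - 1) X w^-1 X)) <=
  expR (- l * V (t - 1) t (t + 1) X v^-1 Z) - expR (- l * V (t - 1) t (t + 1) X w^-1 Z).
Proof.
move=> X0 Z0 k0 l0 v0 vw low; have w0 := lt_trans v0 vw.
rewrite !V_diff// ?(ltW vw)// setIid; set M := k * expR _.
set I := eta t @^-1` _.
have mEI : measurable (sublevel eta (t - 1) (X / l) `&` I).
  by apply: measurableI; [exact: msub | exact: mitv].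
have mEAI : measurable (sublevel eta (t + 1) (Z / l) `&` (sublevel eta (t - 1) (X / l) `&` I)).
  by apply: measurableI; first exact: msub.
rewrite -[sublevel _ _ _ `&` _ `&` I]setIA [sublevel _ _ _ `&` (_ `&` I)]setICA -lee_fin EFinM -!prE//.
apply: (markov_ge_itv meta markov) => //.
- by rewrite mulr_ge0 ?expR_ge0.
- move=> u u' au uu' u'b.
  have u0 : 0 < u by apply: lt_le_trans au; rewrite divr_gt0 ?invr_gt0.
  have u'0 := lt_trans u0 uu'.
  rewrite !prE//; last by apply: measurableI; [exact: msub | exact: mitv].
  rewrite -EFinM lee_fin -/(sublevel _ _ _) -[sublevel _ _ _](setIid).
  rewrite -[in `]u, _]](invr_mul_divK u0 l0) -[in `]_, u']](invr_mul_divK u'0 l0).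
  have p0 : 0 < u * l by rewrite mulr_gt0.
  have p0' : 0 < u' * l by rewrite mulr_gt0.
  have uu'' : (u' * l)^-1 <= (u * l)^-1 by rewrite lef_pV2 ?posrE// ler_pM2r// ltW.
  rewrite -V_diff ?invr_gt0// -marginal_diff ?invr_gt0//.
  have vu' : v <= (u' * l)^-1.
    by rewrite -[v]invrK lef_pV2 ?posrE ?invr_gt0// -ler_pdivlMr.
  have [Vm Vl _] := V_scale_convex meta ms (t + 1) t (t + 1) Z0 Z0.
  apply: (kernel_lower (f := fun x => V (t + 1) t (t + 1) Z x^-1 Z)) => //.
  + apply: Vm; rewrite ?invr_gt0//.
    by rewrite -[w]invrK lef_pV2 ?posrE ?invr_gt0// -ler_pdivrMr.
  + exact: low.
- exact: past_sublevel.
Qed.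

(* A repeated time index turns the trivariate V into a bivariate exponent. *)
Let alpha (u : R) := V (t - 1) t (t - 1) 1 u^-1 1.
Let beta (u : R) := V (t + 1) t (t + 1) 1 u^-1 1.

Let V_unit s (X v : R) : 0 < X -> 0 < v ->
  V s t s X v^-1 X = V s t s 1 (X * v)^-1 1 / X.
Proof.
move=> X0 v0; rewrite -(V_hom meta ms)// ?invr_gt0 ?mulr_gt0//.
by rewrite mulr1 invfM mulrA divff ?mul1r// gt_eqF.
Qed.

Lemma slope_dichotomy (X Z LA LB : R) : 0 < X -> 0 < Z ->
  right_slope alpha X LA -> right_slope beta Z LB ->
  0 < LA -> 0 < LB -> LA = 1 \/ LB = 1.
Proof.
move=> X0 Z0 rA rB.
have eA x : 0 < x -> alpha (X * x) / X = V (t - 1) t (t - 1) X x^-1 X.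
  by move=> x0; rewrite V_unit.
have eB x : 0 < x -> beta (Z * x) / Z = V (t + 1) t (t + 1) Z x^-1 Z.
  by move=> x0; rewrite V_unit.
apply: (@markov_slope_dichotomy _ alpha beta
  (fun v => V (t - 1) t (t + 1) X v^-1 Z) X Z) => //.
- exact: V_scale_convex.
- exact: V_scale_convex.
- move=> l v w l0 v1 vw; have v0 : 0 < v by exact: lt_le_trans v1.
  have w0 := lt_trans v0 vw; rewrite !eA// !eB//; exact: markov_upper.
- move=> k l v w k0 l0 v1 vw low; have v0 : 0 < v by exact: lt_le_trans v1.
  have w0 := lt_trans v0 vw; rewrite !eA// !eB//; apply: markov_lower => // x y vx xy.
  have x0 : 0 < x by exact: lt_le_trans vx.
  by rewrite -!eB//; [exact: low|exact: lt_le_trans xy].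
Qed.

(** A single slope of [alpha] strictly between 0 and 1, played against all slopes of [beta], forces
    each of them to be 0 or 1. *)
Lemma bivariate_law_unit :
  (exists a, 0 <= a <= 1 /\ forall u, 0 < u -> beta u = Num.max u a + 1 - a) \/
  (exists a, 0 <= a <= 1 /\ forall u, 0 < u -> alpha u = Num.max u a + 1 - a).
Proof.
have [h|/existsNP[X /existsNP[LA /not_implyP[X0 /not_implyP[rA nA]]]]] :=
    pselect (forall X L, 0 < X -> right_slope alpha X L -> L = 0 \/ L = 1).
  right; apply: zero_one_slopes_max_affine => //; first exact: V_scale_convex.
  by move=> u; exact: V_bounds.
left; apply: zero_one_slopes_max_affine => //; first exact: V_scale_convex.
  by move=> u; exact: V_bounds.
move=> Z LB Z0 rB.
have [/andP[LA0 _] _ _] := rA; have [/andP[LB0 _] _ _] := rB.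
have [->|LB1] := eqVneq LB 0; first by left.
have LA1 : 0 < LA.
  by rewrite lt_neqAle eq_sym LA0 andbT; apply/eqP => LA1; apply: nA; left.
have LB2 : 0 < LB by rewrite lt_neqAle eq_sym LB0 LB1.
have [LA2|->] := slope_dichotomy X0 Z0 rA rB LA1 LB2; last by right.
by exfalso; apply: nA; right.
Qed.

Let law s a : 0 <= a <= 1 ->
  (forall u, 0 < u -> V s t s 1 u^-1 1 = Num.max u a + 1 - a) ->
  forall y z, 0 < y -> 0 < z ->
    pr P (sublevel eta t y `&` sublevel eta s z) =
    expR (- (Num.max y^-1 (a / z) + (1 - a) / z)).
Proof.
move=> /andP[a0 a1] h y z y0 z0.
have -> : pr P (sublevel eta t y `&` sublevel eta s z) = G P eta s t s z y z.
  by rewrite /G; congr (pr P _); rewrite setICA setIid.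
rewrite -(expR_V meta ms)// -[y in V _ _ _ _ y _]invrK V_unit ?invr_gt0//.
rewrite h ?mulr_gt0 ?invr_gt0//; congr (expR (- _)).
rewrite -addrA mulrDl maxr_pMl ?invr_ge0 ?ltW//.
by rewrite mulrAC divff ?mul1r// gt_eqF.
Qed.

(** For independent standard Frechet [X] and [F], the formula is the probability that [X <= y],
    [a X <= z] and [(1 - a) F <= z], that is, the joint law of [X] and [max (a X, (1 - a) F)]. *)
Lemma bivariate_law : exists a, 0 <= a <= 1 /\
  ((forall y z, 0 < y -> 0 < z -> pr P (sublevel eta t y `&` sublevel eta (t + 1) z) =
      expR (- (Num.max y^-1 (a / z) + (1 - a) / z))) \/
   (forall y z, 0 < y -> 0 < z -> pr P (sublevel eta t y `&` sublevel eta (t - 1) z) =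
      expR (- (Num.max y^-1 (a / z) + (1 - a) / z)))).
Proof.
have [[a [a01 h]]|[a [a01 h]]] := bivariate_law_unit; exists a; split => //.
  by left => y z y0 z0; exact: law.
by right => y z y0 z0; exact: law.
Qed.

End BivariateLaw.

(** * From bivariate laws to the law of the process *)

Section Windows.
Context {R : realType}.

(** The [n + 1] times [s, s - 1, ..., s - n], latest first, so that the coordinate governed by the
    recursion is the head. *)
Definition window {T : Type} (xi : int -> T -> R) (s : int) (n : nat)
  (B : nat -> set R) : set T :=
  \bigcap_(i in `I_n.+1) xi (s - i%:Z) @^-1` B i.

Lemma window0 {T : Type} (xi : int -> T -> R) s B : window xi s 0 B = xi s @^-1` B 0%N.
Proof.
apply/seteqP; split => w; first by move=> /(_ 0%N isT) /=; rewrite subr0.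
by move=> h [|i]// _ /=; rewrite subr0.
Qed.

Lemma windowS {T : Type} (xi : int -> T -> R) s n B :
  window xi s n.+1 B = xi s @^-1` B 0%N `&` window xi (s - 1) n (fun i => B i.+1).
Proof.
have e (i : nat) : s - 1 - i%:Z = s - i.+1%:Z.
  by rewrite -addn1 PoszD opprD addrA addrAC.
apply/seteqP; split => w.
  move=> h; split; first by have := h 0%N isT; rewrite /= subr0.
  by move=> i hi /=; rewrite e; exact: (h i.+1).
move=> [h0 h] [|i] hi /=; first by rewrite subr0.
by rewrite -e; exact: h.
Qed.

Definition add_head (S : set R) (B : nat -> set R) (i : nat) : set R :=
  if i is 0%N then S `&` B 0%N else B i.

Lemma window_add_head {T : Type} (xi : int -> T -> R) s n (S : set R) B :
  xi s @^-1` S `&` window xi s n B = window xi s n (add_head S B).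
Proof.
apply/seteqP; split => w.
  move=> [hS h] [|i] hi; last exact: (h i.+1).
  by split; [rewrite /= subr0|exact: (h 0%N)].
move=> h; split; first by have [] := h 0%N isT; rewrite /= subr0.
by move=> [|i] hi; [have [] := h 0%N isT|exact: (h i.+1)].
Qed.

Lemma add_head_measurable (S : set R) B : measurable S ->
  (forall i, measurable (B i)) -> forall i, measurable (add_head S B i).
Proof. by move=> mS mB [|i] /=; [exact: measurableI|exact: mB]. Qed.

Lemma window_measurable {d} {T : measurableType d} (xi : int -> T -> R) s n B :
  is_process xi -> (forall i, measurable (B i)) -> measurable (window xi s n B).
Proof.
by move=> mxi mB; apply: bigcap_measurableType => i _; exact: measurable_preimage.
Qed.

Lemma joint_eq_halflines {d1 d2} {T1 : measurableType d1} {T2 : measurableType d2}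
  (P1 : probability T1 R) (P2 : probability T2 R) (xi1 : int -> T1 -> R)
  (xi2 : int -> T2 -> R) (t1 t2 : int) (E1 : set T1) (E2 : set T2) (c : R) :
  is_process xi1 -> is_process xi2 -> measurable E1 -> measurable E2 -> 0 <= c ->
  (forall z : R, P1 (xi1 t1 @^-1` `]-oo, z]%classic `&` E1) =
     (c%:E * P2 (xi2 t2 @^-1` `]-oo, z]%classic `&` E2))%E) ->
  forall B : set R, measurable B ->
    P1 (xi1 t1 @^-1` B `&` E1) = (c%:E * P2 (xi2 t2 @^-1` B `&` E2))%E.
Proof.
move=> m1 m2 mE1 mE2 c0 h B mB.
apply: (@measure_eq_halflines R (jointm P1 m1 t1 mE1)
  (mscale (NngNum c0) (jointm P2 m2 t2 mE2)) _ _ h B mB).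
- exact: jointm_fin.
- by rewrite /mscale/= lte_mul_pinfty ?lee_fin//; exact: jointm_fin.
Qed.

(** The marginals are prescribed at positive levels only; the mass below [e > 0] is
    [exp (- 1/e) <= e], and [e] is arbitrary. *)
Lemma frechet_nonpos {d} {T : measurableType d} (P : probability T R)
    (xi : int -> T -> R) t (E : set T) (z : R) :
  is_process xi -> frechet_marginals P xi -> measurable E -> z <= 0 ->
  P (xi t @^-1` `]-oo, z] `&` E) = 0%E.
Proof.
move=> mxi fr mE z0; apply/eqP; rewrite eq_le measure_ge0 andbT.
have m1 (y : R) : measurable (xi t @^-1` `]-oo, y]) by exact: measurable_preimage.
apply/lee_addgt0Pr => e e0; rewrite add0e.
apply: (@le_trans _ _ (P (xi t @^-1` `]-oo, e]))).
  apply: le_measure; rewrite ?inE//; first exact: measurableI.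
  move=> w [/=]; rewrite !in_itv/= => wz _.
  exact: le_trans wz (le_trans z0 (ltW e0)).
rewrite fr// lee_fin expRN -[leRHS]invrK lef_pV2 ?posrE ?expR_gt0 ?invr_gt0//.
by apply: le_trans (expR_ge1Dx _); rewrite lerDr.
Qed.

(** The distributional form of [xi (s + 1) = max (a xi(s), (1 - a) F)], with a Frechet [F]
    independent of the window. Writing [a * x <= z] instead of [x <= z / a] includes [a = 0]. *)
Definition AR_recursion {d} {T : measurableType d} (P : probability T R)
    (xi : int -> T -> R) (a : R) := forall s n (B : nat -> set R) (z : R),
  (forall i, measurable (B i)) -> 0 < z ->
  P (xi (s + 1) @^-1` `]-oo, z]%classic `&` window xi s n B) =
  ((expR (- ((1 - a) / z)))%:E *
    P (xi s @^-1` [set x | (a * x <= z)%R] `&` window xi s n B))%E.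

Lemma measurable_scaled_halfline (a z : R) : measurable [set x : R | a * x <= z].
Proof.
have mf : measurable_fun setT (fun x : R => a * x) by exact: measurable_funM.
have := mf measurableT `]-oo, z]%classic (measurable_itv _).
by rewrite setTI; congr (measurable _).
Qed.

Section Uniqueness.
Context {d1 d2 : measure_display} {T1 : measurableType d1} {T2 : measurableType d2}.
Variables (P1 : probability T1 R) (P2 : probability T2 R).
Variables (xi1 : int -> T1 -> R) (xi2 : int -> T2 -> R) (a : R).
Hypotheses (m1 : is_process xi1) (m2 : is_process xi2).
Hypotheses (f1 : frechet_marginals P1 xi1) (f2 : frechet_marginals P2 xi2).
Hypotheses (r1 : AR_recursion P1 xi1 a) (r2 : AR_recursion P2 xi2 a).

(** The recursion trades a half-line at the latest time for a factor and a smaller set one time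
    earlier, which shortens the window; half-lines determine the law of the latest coordinate. *)
Let window_eq n : forall s B, (forall i, measurable (B i)) ->
  P1 (window xi1 s n B) = P2 (window xi2 s n B).
Proof.
elim: n => [|n IH] s B mB.
  rewrite !window0 -(setIT (xi1 s @^-1` _)) -(setIT (xi2 s @^-1` _)) -[RHS]mul1e.
  apply: joint_eq_halflines => // z; rewrite mul1e.
  have [z0|z0] := leP z 0; first by rewrite !frechet_nonpos.
  by rewrite !setIT f1// f2.
rewrite !windowS -[RHS]mul1e.
have mB' i : measurable (B i.+1) by [].
apply: joint_eq_halflines => //; [exact: window_measurable..|].
move=> z; rewrite mul1e; have [z0|z0] := leP z 0.
  by rewrite !frechet_nonpos//; exact: window_measurable.
have := r1 (s - 1) n mB' z0; have := r2 (s - 1) n mB' z0.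
rewrite subrK => -> ->; rewrite !window_add_head IH//.
by apply: add_head_measurable => //; exact: measurable_scaled_halfline.
Qed.

Lemma AR_recursion_eqd : eqd P1 xi1 P2 xi2.
Proof.
move=> ts Bs mB.
pose M := (\max_(t <- ts) absz t)%N.
(* Sets attached to a repeated time are intersected; a time absent from [ts] gets the empty
   intersection, which is the whole line. *)
pose C (i : nat) : set R :=
  \bigcap_(j in [set j | (j < size ts)%N /\ nth 0 ts j = M%:Z - i%:Z]) Bs j.
have cylE (T : Type) (xi : int -> T -> R) : cyl xi ts Bs = window xi M%:Z (M + M) C.
  apply/seteqP; split => w h.
    by move=> i hi j [hj e]; rewrite /= -e; exact: h.
  move=> j hj; set x := nth 0 ts j.
  have xM : (absz x <= M)%N by apply: leq_bigmax_seq => //; exact: mem_nth.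
  pose i := absz (M%:Z - x).
  have iE : x = M%:Z - i%:Z.
    rewrite /i gez0_abs; first by rewrite opprB addrC subrK.
    rewrite subr_ge0; apply: le_trans (ler_norm _) _.
    by rewrite -abszE lez_nat.
  have hi : (i < (M + M).+1)%N by rewrite ltnS /i; lia.
  by have := h i hi j; rewrite /= -iE; apply.
rewrite !cylE window_eq// => i.
by apply: bigcap_measurableType => j _; exact: mB.
Qed.

End Uniqueness.

End Windows.

(** * The recursion obtained from a bivariate law, in either direction of time *)

Section RecursionOfBivariate.
Context {R : realType} {d : measure_display} {T : measurableType d}.
Variables (P : probability T R) (eta : int -> T -> R).
Hypotheses (meta : is_process eta) (fr : frechet_marginals P eta).
Hypothesis markov : markov_prop P eta.
Variable a : R.
Hypothesis a01 : 0 <= a <= 1.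

Let S z := [set x : R | a * x <= z].
Let mS z : measurable (S z). Proof. exact: measurable_scaled_halfline. Qed.
Let c (z : R) := expR (- ((1 - a) / z)).

(** The factor [exp (- max (1/y, a/z))] is the probability that [eta s <= y] and [a * eta s <= z],
    so both sides agree on half-lines in [y]. *)
Lemma bivariate_borel (s u : int) (z : R) (B : set R) : 0 < z ->
  (forall y, 0 < y -> P (eta s @^-1` `]-oo, y] `&` eta u @^-1` `]-oo, z]) =
      (expR (- (Num.max y^-1 (a / z) + (1 - a) / z)))%:E) ->
  measurable B ->
  P (eta s @^-1` B `&` eta u @^-1` `]-oo, z]) =
  ((c z)%:E * P (eta s @^-1` B `&` eta s @^-1` S z))%E.
Proof.
move=> z0 h mB; have mz (y : R) : measurable (eta u @^-1` `]-oo, y]) by exact: measurable_preimage.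
have ms := measurable_preimage meta s (mS z).
apply: joint_eq_halflines => //; first exact: expR_ge0.
move=> y; have [y0|y0] := leP y 0; first by rewrite !frechet_nonpos// mule0.
have [a0 a1] := andP a01.
rewrite h// opprD expRD mulrC EFinM; congr (_ * _)%E.
have [a00|apos] := eqVneq a 0.
  rewrite a00 mul0r max_l ?invr_ge0 ?ltW// -(fr s y0); congr (P _).
  by apply/seteqP; split => w; rewrite /S /=; [rewrite a00 mul0r; split => //; exact: ltW|case].
have ap : 0 < a by rewrite lt_neqAle eq_sym apos.
have -> : eta s @^-1` `]-oo, y] `&` eta s @^-1` S z =
    eta s @^-1` `]-oo, Num.min y (z / a)].
  apply/seteqP; split => w; rewrite /S /= !in_itv/= le_min ler_pdivlMr// [_ * a]mulrC.
    by move=> [-> ->].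
  by move=> /andP.
rewrite fr; last by rewrite lt_min y0 divr_gt0.
congr (expR (- _))%:E; have [yz|zy] := leP y (z / a).
  by rewrite max_l// -[a / z]invf_div lef_pV2// posrE divr_gt0.
by rewrite max_r ?invf_div// -[a / z]invf_div lef_pV2 ?posrE ?divr_gt0// ltW.
Qed.

(** By the bivariate law, the kernel of [{eta (s + 1) <= z}] is [c z] where [a * x <= z] and 0
    elsewhere; [markov_le] and [markov_ge] carry this over to every window, which is a past
    event. *)
Lemma forward_recursion :
  (forall s y z, 0 < y -> 0 < z -> P (eta s @^-1` `]-oo, y] `&` eta (s + 1) @^-1` `]-oo, z]) =
      (expR (- (Num.max y^-1 (a / z) + (1 - a) / z)))%:E) ->
  AR_recursion P eta a.
Proof.
move=> biv s n B z mB z0; set E := window eta s n B; set A := `]-oo, z]%classic.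
have b C (mC : measurable C) := @bivariate_borel s (s + 1) z C z0 (fun y y0 => biv s y z y0 z0) mC.
have pE : past_sigma eta s E.
  rewrite /E /window bigcap_mkord; apply: past_bigcap => i _.
  by apply: past_preimage => //; rewrite lerBlDr lerDl.
have mE := past_measurable meta pE.
have c0 : 0 <= c z by exact: expR_ge0.
have mSC := measurableC (mS z).
have mA : measurable A by exact: measurable_itv.
have mA' := measurable_preimage meta (s + 1) mA.
have mSs := measurable_preimage meta s (mS z).
have mSCs := measurable_preimage meta s mSC.
have h1 : P (eta (s + 1) @^-1` A `&` (E `&` eta s @^-1` S z)) =
    ((c z)%:E * P (E `&` eta s @^-1` S z))%E.
  apply/eqP; rewrite eq_le; apply/andP; split.
    apply: (markov_le meta markov) => // C mC; rewrite setIC b; last exact: measurableI.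
    by rewrite -preimage_setI -setIA setIid.
  apply: (markov_ge meta markov) => // C mC.
  rewrite [eta (s + 1) @^-1` A `&` _]setIC b; last exact: measurableI.
  by rewrite -preimage_setI -setIA setIid.
have h2 : P (eta (s + 1) @^-1` A `&` (E `&` eta s @^-1` (~` S z))) = 0%E.
  apply/eqP; rewrite eq_le measure_ge0 andbT -(mul0e (P (E `&` eta s @^-1` (~` S z)))).
  apply: (markov_le meta markov) => // C mC; rewrite setIC b; last exact: measurableI.
  by rewrite -preimage_setI -setIA setICl setI0 preimage_set0 measure0 mule0 mul0e.
transitivity (P (eta (s + 1) @^-1` A `&` (E `&` eta s @^-1` S z)) +
    P (eta (s + 1) @^-1` A `&` (E `&` eta s @^-1` (~` S z))))%E;
  last by rewrite h2 adde0 h1 [E `&` _]setIC.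
have mI F : measurable F -> measurable (eta (s + 1) @^-1` A `&` (E `&` F)).
  by move=> mF; apply: measurableI => //; exact: measurableI.
rewrite -measureU; [|exact: mI|exact: mI|].
  by rewrite -setIUr -setIUr -preimage_setU setUv preimage_setT setIT.
by apply/seteqP; split => w //= -[[_ [_ ?]] [_ [_ ?]]].
Qed.

(** Here the new coordinate precedes the window, so the kernel cannot be applied to it. Instead the
    window grows into the future: the events [{eta (r - 1) <= z}] and [{a * eta r <= z}], each
    intersected with the window, induce proportional laws, and [markov_transfer] adds one later
    time. *)
Lemma backward_recursion :
  (forall s y z, 0 < y -> 0 < z -> P (eta s @^-1` `]-oo, y] `&` eta (s - 1) @^-1` `]-oo, z]) =
      (expR (- (Num.max y^-1 (a / z) + (1 - a) / z)))%:E) ->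
  AR_recursion P (fun t => eta (- t)) a.
Proof.
move=> biv s n B z mB z0.
pose D r m (C : nat -> set R) := \bigcap_(i in `I_m.+1) eta (r + i%:Z) @^-1` C i.
have DE r m C : window (fun t => eta (- t)) (- r) m C = D r m C.
  by apply: eq_bigcapr => i _; rewrite opprB addrC opprK.
have DS r m C : D r m.+1 C = eta (r + m.+1%:Z) @^-1` C m.+1 `&` D r m C.
  apply/seteqP; split => w; first by move=> h; split => [|i hi]; apply: h => //=; exact: ltnW.
  move=> [hm h] i; rewrite /= ltnS leq_eqVlt => /orP[/eqP->//|]; exact: h.
suff key k : forall r C, (forall i, measurable (C i)) ->
    P (eta (r - 1) @^-1` `]-oo, z] `&` D r k C) =
    ((c z)%:E * P (eta r @^-1` S z `&` D r k C))%E.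
  by have := key n (- s) B mB; rewrite -opprD -DE !opprK.
elim: k => [|m IH] r C mC.
  have D0 : D r 0%N C = eta r @^-1` C 0%N.
    by rewrite -DE window0 opprK.
  rewrite D0 setIC bivariate_borel//; last by move=> y y0; exact: biv.
  by rewrite [in RHS]setIC.
have pz y : past_sigma eta (r + m%:Z) (eta (r - 1) @^-1` `]-oo, y]).
  apply: past_preimage => //; rewrite lerBlDr -addrA lerDl -[1]/(1%:Z) -PoszD.
  by rewrite lez_nat.
have pS : past_sigma eta (r + m%:Z) (eta r @^-1` S z).
  by apply: past_preimage => //; rewrite lerDl lez_nat.
have pD : past_sigma eta (r + m%:Z) (D r m C).
  rewrite /D bigcap_mkord; apply: past_bigcap => i _.
  by apply: past_preimage => //; rewrite lerD2l lez_nat -ltnS.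
rewrite DS -addn1 PoszD addrA setICA [in RHS]setICA.
apply: (markov_transfer meta markov) => //; first exact: expR_ge0.
- exact: past_setI.
- exact: past_setI.
move=> A mA.
(* The Borel test set [A] at the latest time is absorbed into the last set of the window; the
   induction hypothesis is quantified over [C] for this purpose. *)
pose C' i := if i == m then A `&` C m else C i.
have mC' i : measurable (C' i).
  by rewrite /C'; case: ifP => // _; exact: measurableI.
have DC : eta (r + m%:Z) @^-1` A `&` D r m C = D r m C'.
  apply/seteqP; split => w.
    move=> [hA h] i hi; rewrite /C'; case: eqP => [->|_]; last exact: h.
    by split => //; apply: h => /=.
  move=> h; split; first by have := h m (ltnSn m); rewrite /C' eqxx => -[].
  move=> i hi; have := h i hi; rewrite /C'; case: eqP => [->|//].
  by move=> [].
by rewrite setICA DC [in RHS]setICA DC; exact: IH.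
Qed.

End RecursionOfBivariate.

(** * Max-AR(1) processes *)

Section MaxARMeasurability.
Context {R : realType}.

Definition ar_term {T : Type} (a : R) (F : int -> T -> R) (t : int) (k : nat) (w : T) : R :=
  (1 - a) * a ^+ k * F (t - k%:Z) w.

Definition ar_sup {T : Type} (a : R) (F : int -> T -> R) (t : int) (w : T) : \bar R :=
  ereal_sup (range (fun k => (ar_term a F t k w)%:E)).

Lemma maxAR_sup {T : Type} (a : R) (F : int -> T -> R) t w : a != 1 ->
  maxAR a F t w = fine (ar_sup a F t w).
Proof.
move=> a1; rewrite /maxAR (negbTE a1); congr (fine (ereal_sup _)).
apply/seteqP; split => [_ [n nt <-]|_ [k _ <-]].
  exists (absz (t - n)) => //; congr (_%:E).
  rewrite /ar_term; congr (_ * F _ w).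
  by rewrite gez0_abs ?subr_ge0// opprB addrC subrK.
exists (t - k%:Z); first by rewrite /= lerBlDr lerDl.
by rewrite opprB addrC subrK absz_nat.
Qed.

(** Measurability is asked of the noise up to time [t] only, so that the lemma also applies over the
    sigma-algebra generated by the past noise. *)
Lemma maxAR_measurable {d} {T : measurableType d} (a : R) (F : int -> T -> R) t :
  (forall k : nat, measurable_fun setT (F (t - k%:Z))) ->
  a != 1 -> measurable_fun setT (maxAR a F t).
Proof.
move=> mF a1; rewrite (_ : maxAR a F t = fine \o ar_sup a F t); last first.
  by apply/funext => w; exact: maxAR_sup.
apply: measurableT_comp; first exact: fine_measurable.
rewrite (_ : ar_sup a F t = fun w => esups (fun k => (ar_term a F t k w)%:E) 0%N).
  apply: measurable_fun_esups => k; apply/measurable_EFinP.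
  by apply: measurable_funM => //; exact: mF.
apply/funext => w; congr (ereal_sup _); apply/seteqP; split => _ [k _ <-]; by exists k.
Qed.

Lemma ar_sup_le {T : Type} (a : R) (F : int -> T -> R) t w (y : R) :
  (ar_sup a F t w <= y%:E)%E <-> forall k, ar_term a F t k w <= y.
Proof.
split=> [/ereal_supP h k|h]; first by rewrite -lee_fin; apply: h; exists k.
by apply/ereal_supP => _ [k _ <-]; rewrite lee_fin.
Qed.

Lemma maxAR_le {T : Type} (a : R) (F : int -> T -> R) t w (y : R) : a != 1 ->
  ar_sup a F t w != +oo%E ->
  maxAR a F t w <= y <-> forall k, ar_term a F t k w <= y.
Proof.
move=> a1 fin; rewrite maxAR_sup// -ar_sup_le.
have ny : ar_sup a F t w != -oo%E.
  rewrite -ltNye; apply: (@lt_le_trans _ _ (ar_term a F t 0%N w)%:E); first exact: ltNyr.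
  by apply: ereal_sup_ubound; exists 0%N.
by rewrite -lee_fin fineK// fin_numE ny fin.
Qed.

End MaxARMeasurability.

(** * Marginals and recursion of the max-AR(1) process with [a < 1] *)

Section MaxARLaw.
Context {R : realType} {d : measure_display} {T : measurableType d}.
Variables (P : probability T R) (F : int -> T -> R) (a : R).
Hypotheses (iid : iid_frechet P F) (a01 : 0 <= a <= 1).

Let mF : is_process F. Proof. by have [] := iid. Qed.
Let frF : frechet_marginals P F. Proof. by have [_ []] := iid. Qed.

Definition past_noise (s : int) : set (set T) :=
  [set D | exists (K : nat) (B : nat -> set R),
     (forall k, measurable (B k)) /\ D = \bigcap_(k in `I_K) F (s - k%:Z) @^-1` B k].

Let past_noise_cyl (s : int) K (B : nat -> set R) :
  \bigcap_(k in `I_K) F (s - k%:Z) @^-1` B k =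
  cyl F [seq s - k%:Z | k <- iota 0 K] B.
Proof.
rewrite /cyl size_map size_iota; apply: eq_bigcapr => k hk.
by rewrite (nth_map 0%N) ?size_iota// nth_iota.
Qed.

Let uniq_past (s : int) K : uniq [seq s - k%:Z | k <- iota 0 K].
Proof.
by rewrite map_inj_uniq ?iota_uniq// => i j /addrI /oppr_inj [].
Qed.

Lemma past_noise_measurable s : past_noise s `<=` measurable.
Proof.
move=> _ [K [B [mB ->]]]; apply: bigcap_measurableType => k _.
exact: measurable_preimage.
Qed.

Lemma past_noise_setI s : setI_closed (past_noise s).
Proof.
move=> _ _ [K [B [mB ->]]] [L [C [mC ->]]].
exists (maxn K L), (fun k => (if (k < K)%N then B k else setT) `&`
   (if (k < L)%N then C k else setT)); split.
  by move=> k; apply: measurableI; case: ifP.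
apply/seteqP; split => w.
  move=> [hB hC] k /= _; split; case: ifP => // hk; [exact: hB|exact: hC].
move=> h; split => k /= hk; have := h k; rewrite /= leq_max hk ?orbT => /(_ isT) [].
  by [].
by [].
Qed.

Lemma noise_independent_cyl s (C : set R) K (B : nat -> set R) : measurable C ->
  (forall k, measurable (B k)) ->
  P (F (s + 1) @^-1` C `&` \bigcap_(k in `I_K) F (s - k%:Z) @^-1` B k) =
  (P (F (s + 1) @^-1` C) * P (\bigcap_(k in `I_K) F (s - k%:Z) @^-1` B k))%E.
Proof.
move=> mC mB; have [_ [_ ind]] := iid.
pose B' i := if i is i'.+1 then B i' else C.
have mB' i : measurable (B' i) by case: i.
rewrite past_noise_cyl; set ns := [seq _ | _ <- _].
have -> : F (s + 1) @^-1` C `&` cyl F ns B = cyl F (s + 1 :: ns) B'.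
  apply/seteqP; split => w; first by move=> [h0 h] [|i] hi //; exact: (h i).
  by move=> h; split => [|i hi]; [exact: (h 0%N)|exact: (h i.+1)].
have uns : uniq ns by exact: uniq_past.
rewrite ind//; last by rewrite cons_uniq uns andbT; apply/mapP => -[k _]; lia.
by rewrite big_ord_recl ind.
Qed.

(** Cylinders of the past noise form a pi-system; on it the restriction of [P] to
    [{F (s + 1) \in C}] coincides with a multiple of [P], hence also on the generated
    sigma-algebra. *)
Lemma noise_independent s (C : set R) (D : set T) : measurable C ->
  <<s past_noise s >> D ->
  P (F (s + 1) @^-1` C `&` D) = (P (F (s + 1) @^-1` C) * P D)%E.
Proof.
move=> mC hD.
have mFC : measurable (F (s + 1) @^-1` C) by exact: measurable_preimage.
pose p : {nonneg R} := NngNum (fine_ge0 (measure_ge0 P (F (s + 1) @^-1` C))).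
have pE : P (F (s + 1) @^-1` C) = (p%:num)%:E by rewrite /= fineK// fin_num_measure.
rewrite pE setIC.
apply: (g_sigma_algebra_measure_unique (past_noise s) (@past_noise_measurable s)
  (fun _ => setT) _ _ (mrestr P mFC) (mscale p P)) => //.
- move=> _; exists 0%N, (fun _ => setT); split => //.
  by rewrite II0 bigcap_set0.
- by rewrite bigcup_const//; exists 0%N.
- exact: past_noise_setI.
- move=> _ [K [B [mB ->]]]; have e := noise_independent_cyl s K mC mB.
  by rewrite setIC pE in e; exact: e.
- move=> _; rewrite /= /mrestr setTI; apply: (le_lt_trans (probability_le1 _ _)) => //; exact: ltry.
Qed.

Lemma noise_past_measurable s (k : nat) :
  measurable_fun setT (F (s - k%:Z) : g_sigma_algebraType (past_noise s) -> R).
Proof.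
move=> _ B mB; rewrite setTI; apply: sub_sigma_algebra.
exists k.+1, (fun i => if i == k then B else setT); split.
  by move=> i; case: ifP.
apply/seteqP; split => w.
  by move=> h i _ /=; case: eqP => [->|].
by move=> /(_ k (ltnSn k)); rewrite /= eqxx.
Qed.

Hypothesis a_neq1 : a != 1.

Let a0 : 0 <= a. Proof. by have /andP[] := a01. Qed.
Let a1 : a < 1. Proof. by have /andP[_ h] := a01; rewrite lt_neqAle a_neq1. Qed.

Lemma noise_scaled_le n (b y : R) : 0 <= b -> 0 < y ->
  P (F n @^-1` [set v | b * v <= y]) = (expR (- (b / y)))%:E.
Proof.
move=> b0 y0; have [->|bn0] := eqVneq b 0.
  rewrite mul0r oppr0 expR0 -(probability_setT P); congr (P _).
  by apply/seteqP; split => w //= _; rewrite mul0r ltW.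
have bp : 0 < b by rewrite lt_neqAle eq_sym bn0.
rewrite -[b / y]invf_div -(frF n) ?divr_gt0//; congr (P _).
by apply/seteqP; split => w /=; rewrite in_itv/= ler_pdivlMr// mulrC.
Qed.

Let below t (y : R) : set T := [set w | forall k, ar_term a F t k w <= y].

Let belowE t y : below t y =
  \bigcap_K \bigcap_(k in `I_K) F (t - k%:Z) @^-1` [set v | (1 - a) * a ^+ k * v <= y].
Proof.
apply/seteqP; split => w; first by move=> h K _ k _; exact: h.
by move=> h k; exact: (h k.+1 I k (ltnSn k)).
Qed.

Let below_measurable t y : measurable (below t y).
Proof.
rewrite belowE; apply: bigcap_measurableType => K _.
apply: bigcap_measurableType => k _; apply: measurable_preimage => //.
exact: measurable_scaled_halfline.
Qed.

(** The first [K] terms are independent with exponents [(1 - a) a^k / y], which sum to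
    [(1 - a^K) / y]; continuity from above and [a < 1] give the limit. *)
Let P_below t (y : R) : 0 < y -> P (below t y) = (expR (- y^-1))%:E.
Proof.
move=> y0; rewrite belowE.
set A := fun K : nat => \bigcap_(k in `I_K) F (t - k%:Z) @^-1`
  [set v | (1 - a) * a ^+ k * v <= y].
have mA K : measurable (A K).
  apply: bigcap_measurableType => k _; apply: measurable_preimage => //.
  exact: measurable_scaled_halfline.
have PA K : P (A K) = (expR (- ((1 - a ^+ K) / y)))%:E.
  have [_ [_ ind]] := iid.
  rewrite /A past_noise_cyl ind//; last by move=> i; exact: measurable_scaled_halfline.
  rewrite size_map size_iota.
  have -> : 1 - a ^+ K = \sum_(i < K) (1 - a) * a ^+ i.
    by rewrite -mulr_sumr -opprB subrX1 -mulNr opprB.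
  rewrite mulr_suml -sumrN expR_sum (big_morph EFin (@EFinM R) erefl); apply: eq_bigr => i _.
  by rewrite noise_scaled_le// mulr_ge0 ?exprn_ge0// subr_ge0 ltW.
have c1 : P (A K) @[K --> \oo] --> P (\bigcap_K A K).
  apply: nonincreasing_cvg_mu => //.
  - by apply: (le_lt_trans (probability_le1 _ _)) => //; exact: ltry.
  - exact: bigcap_measurableType.
  - move=> m n mn; apply/subsetPset => w h k hk; apply: h.
    exact: leq_trans mn.
have mI : measurable (\bigcap_K A K) by exact: bigcap_measurableType.
have c2 : fine (P (A K)) @[K --> \oo] --> fine (P (\bigcap_K A K)).
  by apply: fine_cvg; rewrite fineK// fin_num_measure.
have c3 : fine (P (A K)) @[K --> \oo] --> expR (- y^-1).
  under eq_fun do rewrite PA.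
  apply: continuous_cvg; first exact: continuous_expR.
  rewrite -[- y^-1]/(- y^-1) (_ : - y^-1 = - ((1 - 0) / y)); last by rewrite subr0 mul1r.
  apply: cvgN.
  apply: cvgM; last exact: cvg_cst.
  by apply: cvgB; [exact: cvg_cst|apply: cvg_expr; rewrite ger0_norm].
by rewrite -[LHS]fineK ?fin_num_measure// (cvg_unique _ c2 c3).
Qed.

(* On this null set maxAR takes the junk value fine +oo = 0. *)
Let infinite t : set T := ar_sup a F t @^-1` [set +oo%E].

Let ar_sup_measurable t : measurable_fun setT (ar_sup a F t).
Proof.
rewrite (_ : ar_sup a F t = fun w => esups (fun k => (ar_term a F t k w)%:E) 0%N).
  apply: measurable_fun_esups => k; apply/measurable_EFinP.
  by apply: measurable_funM => //; exact: mF.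
apply/funext => w; congr (ereal_sup _); apply/seteqP; split => _ [k _ <-]; by exists k.
Qed.

Let infinite_measurable t : measurable (infinite t).
Proof. by rewrite -[X in measurable X]setTI; exact: ar_sup_measurable. Qed.

Let infinite_null t : P (infinite t) = 0%E.
Proof.
apply/eqP; rewrite eq_le measure_ge0 andbT; apply/lee_addgt0Pr => e e0; rewrite add0e.
have y0 : 0 < e^-1 by rewrite invr_gt0.
apply: (@le_trans _ _ (P (~` below t e^-1))).
  apply: le_measure; rewrite ?inE//; first exact: measurableC.
  by move=> w; rewrite /infinite/= => e1 /ar_sup_le; rewrite e1 leye_eq.
rewrite probability_setC// P_below// invrK -EFinB lee_fin.
have := expR_ge1Dx (- e); lra.
Qed.

Let eq_mod_null (A B N : set T) : measurable A -> measurable B -> measurable N ->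
  P N = 0%E -> (forall w, ~ N w -> A w <-> B w) -> P A = P B.
Proof.
move=> mA mB mN N0 AB; rewrite -(measureD_null mA mN N0) -(measureD_null mB mN N0).
by congr (P _); apply/seteqP; split => w [h n]; split => //; exact/(AB w n).
Qed.

Lemma maxAR_process_lt1 : is_process (maxAR a F).
Proof. by move=> t; apply: maxAR_measurable => // k; exact: mF. Qed.

Lemma maxAR_frechet_lt1 : frechet_marginals P (maxAR a F).
Proof.
move=> t y y0; rewrite -(P_below t y0).
apply: (@eq_mod_null _ _ (infinite t)) => //.
  by apply: measurable_preimage => //; exact: maxAR_process_lt1.
move=> w n; rewrite /= in_itv/= maxAR_le//; exact/eqP.
Qed.

(** Outside a null set, the value at [s + 1] is at most [z] exactly when [(1 - a) F (s + 1) <= z]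
    and [a] times the value at [s] is at most [z]. The new noise is independent of the window, a
    function of the past noise. *)
Lemma maxAR_recursion_lt1 : AR_recursion P (maxAR a F) a.
Proof.
move=> s n B z mB z0; set W := window _ _ _ _; pose S := [set x : R | a * x <= z].
have mS : measurable S by exact: measurable_scaled_halfline.
pose C := [set v : R | (1 - a) * v <= z].
have mC : measurable C by exact: measurable_scaled_halfline.
have mX := maxAR_process_lt1.
have mW : measurable W by exact: window_measurable.
have <- : P (F (s + 1) @^-1` C `&` (maxAR a F s @^-1` [set x : R | a * x <= z] `&` W)) =
    ((expR (- ((1 - a) / z)))%:E * P (maxAR a F s @^-1` [set x : R | (a * x <= z)%R] `&` W))%E.
  rewrite noise_independent//.
    by rewrite noise_scaled_le// subr_ge0 ltW.
  pose T' := g_sigma_algebraType (past_noise s).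
  have mX' (i : nat) : measurable_fun setT (maxAR a F (s - i%:Z) : T' -> R).
    apply: (@maxAR_measurable R _ T') => // k.
    by rewrite -addrA -opprD -PoszD; exact: noise_past_measurable.
  have mpre (i : nat) (A : set R) : measurable A ->
      @measurable _ T' (maxAR a F (s - i%:Z) @^-1` A).
    by move=> mA; rewrite -[X in measurable X]setTI; exact: mX'.
  apply: (@measurableI _ T'); first by have := mpre 0%N _ mS; rewrite subr0.
  by apply: (@bigcap_measurableType _ T') => i _; exact: mpre.
apply: (@eq_mod_null _ _ (infinite s `|` infinite (s + 1))).
- by apply: measurableI => //; apply: measurable_preimage => //; exact: measurable_itv.
- apply: measurableI; first exact: measurable_preimage.
  by apply: measurableI => //; exact: measurable_preimage.
- exact: measurableU.
- transitivity (P (infinite s)); last exact: infinite_null.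
  exact: (measureU0 (infinite_measurable s) (infinite_measurable (s + 1)) (infinite_null _)).
move=> w /not_orP[ns ns1].
have e0 : ar_term a F (s + 1) 0 w = (1 - a) * F (s + 1) w.
  by rewrite /ar_term expr0 mulr1 subr0.
have eS k : ar_term a F (s + 1) k.+1 w = a * ar_term a F s k w.
  rewrite /ar_term -addn1 PoszD opprD addrACA subrr addr0 addn1 exprS.
  by ring.
have XS : maxAR a F (s + 1) w <= z <->
    (1 - a) * F (s + 1) w <= z /\ a * maxAR a F s w <= z.
  rewrite maxAR_le//; last exact/eqP.
  have Xs y := @maxAR_le _ _ a F s w y a_neq1 (introN eqP ns).
  split=> [h|[h1 h2] [|k]].
  - split; first by rewrite -e0; exact: h.
    have [->|an0] := eqVneq a 0; first by rewrite mul0r ltW.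
    have ap : 0 < a by rewrite lt_neqAle eq_sym an0.
    rewrite mulrC -ler_pdivlMr//; apply/Xs => k.
    by rewrite ler_pdivlMr// mulrC -eS; exact: h.
  - by rewrite e0.
  - rewrite eS; apply: le_trans h2; apply: ler_wpM2l => //.
    by apply: (Xs _).1.
split.
  by move=> [] /=; rewrite in_itv/= => /XS[h1 h2] hW; split.
by move=> [h1 [h2 hW]]; split => //=; rewrite in_itv/=; apply/XS.
Qed.

End MaxARLaw.

Section MaxARAll.
Context {R : realType} {d : measure_display} {T : measurableType d}.
Variables (P : probability T R) (F : int -> T -> R) (a : R).
Hypotheses (iid : iid_frechet P F) (a01 : 0 <= a <= 1).

Lemma maxAR_process : is_process (maxAR a F).
Proof.
have [->|a1] := eqVneq a 1; last exact: maxAR_process_lt1 iid a1.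
by move=> t; rewrite /maxAR eqxx; have [mF _] := iid; exact: mF.
Qed.

Lemma maxAR_frechet : frechet_marginals P (maxAR a F).
Proof.
have [->|a1] := eqVneq a 1; last exact: maxAR_frechet_lt1.
by move=> t; rewrite /maxAR eqxx; have [_ [fr _]] := iid; exact: fr.
Qed.

Lemma maxAR_recursion : AR_recursion P (maxAR a F) a.
Proof.
have [->|a1] := eqVneq a 1; last exact: maxAR_recursion_lt1.
move=> s n B z mB z0; rewrite subrr mul0r oppr0 expR0 mul1e.
congr (P (_ `&` _)); rewrite /maxAR eqxx.
by apply/seteqP; split => w /=; rewrite in_itv/= mul1r.
Qed.

End MaxARAll.

(** * Reversal of time and conclusion *)

Section TimeReversal.
Context {R : realType}.

Lemma cyl_opp {T : Type} (xi : int -> T -> R) ts Bs :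
  cyl (fun t => xi (- t)) ts Bs = cyl xi (map -%R ts) Bs.
Proof.
by rewrite /cyl size_map; apply: eq_bigcapr => i hi; rewrite (nth_map 0).
Qed.

Lemma eqd_opp {d1 d2} {T1 : measurableType d1} {T2 : measurableType d2}
  (P1 : probability T1 R) (P2 : probability T2 R) (xi1 : int -> T1 -> R)
  (xi2 : int -> T2 -> R) :
  eqd P1 (fun t => xi1 (- t)) P2 (fun t => xi2 (- t)) -> eqd P1 xi1 P2 xi2.
Proof.
move=> h ts Bs mB; have := h (map -%R ts) Bs mB.
by rewrite !cyl_opp -map_comp map_id_in// => t _; rewrite /= opprK.
Qed.

Lemma iid_frechet_opp {d} {T : measurableType d} (P : probability T R)
    (F : int -> T -> R) :
  iid_frechet P F -> iid_frechet P (fun n => F (- n)).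
Proof.
move=> [mF [fF ind]]; split; first by move=> n; exact: mF.
split; first by move=> n; exact: fF.
move=> ns Bs uns mB; rewrite cyl_opp ind//; last by rewrite (map_inj_uniq oppr_inj).
by rewrite size_map; apply: eq_bigr => i _; rewrite (nth_map 0).
Qed.

Lemma rmaxAR_opp {T : Type} (a : R) (F : int -> T -> R) :
  (fun t => rmaxAR a F (- t)) = maxAR a (fun n => F (- n)).
Proof.
apply/funext => t; apply/funext => w; rewrite /rmaxAR /maxAR oppr0.
case: ifP => // _; congr (fine (ereal_sup _)).
apply/seteqP; split => _ [n /= nt <-]; exists (- n); rewrite ?opprK//.
- by rewrite lerNl.
- by rewrite addrC.
- by rewrite lerN2.
- by rewrite addrC.
Qed.

Lemma stationary_pair {d} {T : measurableType d} (P : probability T R)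
    (eta : int -> T -> R) (s t u : int) (A B : set R) :
  stationary P eta -> measurable A -> measurable B ->
  P (eta (t + s) @^-1` A `&` eta (u + s) @^-1` B) =
  P (eta t @^-1` A `&` eta u @^-1` B).
Proof.
move=> st mA mB; pose Bs i := if i is 0%N then A else B.
have mBs i : measurable (Bs i) by case: i.
have cyl2 (xi : int -> T -> R) :
    cyl xi [:: t; u] Bs = xi t @^-1` A `&` xi u @^-1` B.
  apply/seteqP; split => w; last by move=> [hA hB] [|[|i]].
  by move=> h; split; [exact: (h 0%N)|exact: (h 1%N)].
by have := st s [:: t; u] Bs mBs; rewrite !cyl2.
Qed.

End TimeReversal.

Unset Implicit Arguments.

Theorem theorem1 (R : realType) (d : measure_display) (T : measurableType d)
  (P : probability T R) (eta : int -> T -> R) :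
  is_process eta ->
  stationary P eta -> simple_max_stable P eta -> markov_prop P eta ->
  exists a : R, 0 <= a <= 1 /\
    ((forall (d' : measure_display) (T' : measurableType d')
        (P' : probability T' R) (F : int -> T' -> R),
        iid_frechet P' F -> eqd P eta P' (maxAR a F)) \/
     (forall (d' : measure_display) (T' : measurableType d')
        (P' : probability T' R) (F : int -> T' -> R),
        iid_frechet P' F -> eqd P eta P' (rmaxAR a F))).
Proof.
move=> meta st ms mk; have [fr _] := ms.
(* Stationarity carries the bivariate law found at time 0 to all times, so that one [a] and one
   direction of time serve throughout. *)
have shift s u (y z : R) (c : R) :
    pr P (sublevel eta 0 y `&` sublevel eta u z) = c ->
    P (eta s @^-1` `]-oo, y] `&` eta (s + u) @^-1` `]-oo, z]) = c%:E.
  move=> <-; rewrite -prE; last by apply: measurableI; exact: sublevel_measurable.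
  have := stationary_pair s 0 u st (measurable_itv `]-oo, y]) (measurable_itv `]-oo, z]).
  by rewrite add0r [u + s]addrC.
have [a [a01 [h|h]]] := bivariate_law meta ms mk 0; exists a; split => //.
- left => d' T' P' F iid; apply: (AR_recursion_eqd (a := a)) => //.
  + exact: maxAR_process iid.
  + exact: maxAR_frechet.
  + apply: (forward_recursion meta fr mk a01) => s y z y0 z0.
    by apply: shift; rewrite -h// add0r.
  + exact: maxAR_recursion.
(* Reversing time turns [rmaxAR] into [maxAR] driven by the reversed noise, which is again i.i.d.,
   and the reversed [eta] satisfies the same recursion. *)
- right => d' T' P' F iid; apply: eqd_opp; rewrite rmaxAR_opp.
  have iid' := iid_frechet_opp iid.
  apply: (AR_recursion_eqd (a := a)) => //.
  + exact: maxAR_process iid'.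
  + by move=> t; exact: fr.
  + exact: maxAR_frechet.
  + apply: (backward_recursion meta fr mk a01) => s y z y0 z0.
    by apply: shift; rewrite -h// add0r.
  + exact: maxAR_recursion.
Qed.
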